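(* Let $n,k\ge 1$ be integers, let $0<\alpha\le k$, and let $B\subset\mathbb{R}^k\times\mathbb{R}^n$ be a non-empty Borel set such that $\mathrm{proj}_{\mathbb{R}^k}B\subset T$, where $T\subset\mathbb{R}^k$ is an Ahlfors--David $\alpha$-regular set. Then there exists a Borel set $G\subset B$ such that $G$ is $\Gamma_\alpha$-null and $B'=B\setminus G$ has the Fubini property. Moreover, if $B$ is not $\Gamma_\alpha$-null, then $\dim\mathrm{proj}_{\mathbb{R}^k}B'=\alpha$, and thus $\dim B'=\alpha+\beta'$, where $\beta'=\mathrm{ess}^{\alpha}\text{-}\sup(\dim B'_t)$.
   Context: $\dim$ denotes Hausdorff dimension and $\mathcal{H}^s$ the $s$-dimensional Hausdorff measure. $\mathrm{proj}_{\mathbb{R}^k}$ is the projection of $\mathbb{R}^k\times\mathbb{R}^n$ to the first factor. For $B\subset\mathbb{R}^k\times\mathbb{R}^n$ and $t\in\mathbb{R}^k$, $B_t=\{x\in\mathbb{R}^n:(t,x)\in B\}$. A Borel set $T\subset\mathbb{R}^k$ is Ahlfors--David $\alpha$-regular if there are $c,c'>0$ such that $c\,r^\alpha\le\mathcal{H}^\alpha(T\cap B(t,r))\le c'\,r^\alpha$ for all $t\in T$ and $0<r\le 1$, where $B(t,r)$ is the open ball. A set $G\subset\mathbb{R}^k\times\mathbb{R}^n$ is $\Gamma_\alpha$-null if for every Lipschitz map $f:\mathbb{R}^k\to\mathbb{R}^n$ we have $\mathcal{H}^\alpha(\{t\in\mathbb{R}^k:(t,f(t))\in G\})=0$. Essential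 supremum: for a non-empty $B\subset\mathbb{R}^k\times\mathbb{R}^n$ let $A=\mathrm{proj}_{\mathbb{R}^k}B$ and $\alpha=\dim A$. If $\mathcal{H}^\alpha(A)>0$, define $\mathrm{ess}^{\alpha}\text{-}\sup(\dim B_t)=\sup\{q\ge 0:\mathcal{H}^\alpha(\{t\in\mathbb{R}^k:\dim B_t>q\})>0\}$, with $\sup\emptyset=0$. If $\mathcal{H}^\alpha(A)=0$, define $\mathrm{ess}^{\alpha}\text{-}\sup(\dim B_t)=\lim_{\varepsilon\to0+}\mathrm{ess}^{\alpha-\varepsilon}\text{-}\sup(\dim B_t)$, where $\mathrm{ess}^{\alpha-\varepsilon}\text{-}\sup$ is given by the same supremum formula with $\mathcal{H}^{\alpha-\varepsilon}$ in place of $\mathcal{H}^\alpha$. Fubini property: a non-empty set $B\subset\mathbb{R}^k\times\mathbb{R}^n$ has the Fubini property if $\dim B=\alpha_B+\beta_B$, where $\alpha_B=\dim\mathrm{proj}_{\mathbb{R}^k}B$ and $\beta_B=\mathrm{ess}^{\alpha_B}\text{-}\sup(\dim B_t)$. *)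

(* Defs.v *)
From HB Require Import structures.
From mathcomp Require Import all_boot all_order all_algebra.
From mathcomp Require Import all_classical all_reals all_analysis.
Set Implicit Arguments.
Unset Strict Implicit.
Unset Printing Implicit Defensive.
Import Order.TTheory GRing.Theory Num.Theory.
Import numFieldNormedType.Exports.
Local Open Scope classical_set_scope.
Local Open Scope ring_scope.

(* The norm of the library on 'rV[R]_n and the one on products are maximum
   norms, so the Euclidean distances are introduced explicitly; they induce
   the library topologies, hence the same Borel sets. *)
Definition edistv (R : realType) (n : nat) (x y : 'rV[R]_n) : R :=
  Num.sqrt (\sum_(i < n) (x 0 i - y 0 i) ^+ 2).

Definition edistp (R : realType) (k n : nat) (p q : 'rV[R]_k * 'rV[R]_n) : R :=
  Num.sqrt (edistv p.1 q.1 ^+ 2 + edistv p.2 q.2 ^+ 2).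

Definition borel (T : topologicalType) (A : set T) : Prop :=
  <<s [set U : set T | open U] >> A.

Section Hausdorff.
Variables (R : realType) (T : Type) (d : T -> T -> R).
Local Open Scope ereal_scope.

Definition ediam (E : set T) : \bar R :=
  ereal_sup [set (d xy.1 xy.2)%:E | xy in E `*` E].

(* diam(E)^s, where diam(set0)^s = 0 even for s = 0, while a singleton has
   0 `^ 0 = 1: thus the 0-dimensional measure is the counting measure. *)
Definition diam_pow (s : R) (E : set T) : \bar R :=
  if pselect (E = set0) then 0 else ediam E `^ s.

Definition hcover (delta : R) (A : set T) (E : nat -> set T) : Prop :=
  A `<=` \bigcup_i E i /\ forall i, ediam (E i) <= delta%:E.

Definition hpremeasure (delta s : R) (A : set T) : \bar R :=
  ereal_inf [set \sum_(0 <= i <oo) diam_pow s (E i) | E in hcover delta A].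

(* The s-dimensional Hausdorff (outer) measure, without normalizing factor. *)
Definition hmeasure (s : R) (A : set T) : \bar R :=
  ereal_sup [set hpremeasure delta s A | delta in [set delta : R | (0 < delta)%R]].

Definition hdim (A : set T) : \bar R :=
  ereal_inf [set s%:E | s in [set s : R | (0 <= s)%R /\ hmeasure s A = 0]].

End Hausdorff.

Section Fubini.
Variables (R : realType) (k n : nat).
Local Notation Rk := 'rV[R]_k.
Local Notation Rn := 'rV[R]_n.
Local Open Scope ereal_scope.

Definition ad_regular (alpha : R) (T : set Rk) : Prop :=
  borel T /\
  exists c c' : R, [/\ (0 < c)%R, (0 < c')%R &
    forall (t : Rk) (r : R), T t -> (0 < r <= 1)%R ->
      (c * r `^ alpha)%:E
        <= hmeasure (@edistv R k) alpha
             (T `&` [set u | (edistv t u < r)%R])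
        <= (c' * r `^ alpha)%:E].

Definition elipschitz (f : Rk -> Rn) : Prop :=
  exists L : R, forall s t : Rk, (edistv (f s) (f t) <= L * edistv s t)%R.

Definition Gamma_null (alpha : R) (G : set (Rk * Rn)) : Prop :=
  forall f : Rk -> Rn, elipschitz f ->
    hmeasure (@edistv R k) alpha [set t | G (t, f t)] = 0.

Definition base_proj (B : set (Rk * Rn)) : set Rk := fst @` B.

(* The maximum with 0 implements the convention sup set0 = 0. *)
Definition sup_dim_section (s : R) (B : set (Rk * Rn)) : \bar R :=
  maxe 0 (ereal_sup [set q%:E | q in [set q : R | (0 <= q)%R /\
    0 < hmeasure (@edistv R k) s
          [set t | q%:E < hdim (@edistv R n) (xsection B t)]]]).

(* Only meaningful for alpha = dim (base_proj B). *)
Definition ess_sup_dim (alpha : R) (B : set (Rk * Rn)) : \bar R :=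
  if 0 < hmeasure (@edistv R k) alpha (base_proj B) then sup_dim_section alpha B
  else lim (sup_dim_section (alpha - e)%R B @[e --> 0%R^'+]).

Definition fubini_property (B : set (Rk * Rn)) : Prop :=
  B !=set0 /\
  let alphaB := hdim (@edistv R k) (base_proj B) in
  hdim (@edistp R k n) B = alphaB + ess_sup_dim (fine alphaB) B.

End Fubini.

(* Main.v *)
(** Suppose that H^q(B_t) = 0 for H^alpha-a.e. t in T, and delete the other
    sections, which form a [Gamma_alpha]-null set. Each B_t then has dyadic
    covers (J) of small sum |J|^q. These covers can be chosen measurably in t:
    integrating the dyadic net content of the sections over t gives a capacity
    on the product, continuous along increasing sequences because net contents
    are strongly subadditive. By Choquet's theorem this capacity vanishes on B
    as soon as it vanishes on the compact subsets of B, where finitely many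
    boxes suffice. Hence there are measurable sets e_J such that the e_J x J
    cover B and the sum of |J|^q H^alpha(e_J) is at most eps.

    Cut T into pieces I of size |J| and keep the box I x J when H^alpha(e_J n I)
    is at least delta |J|^(alpha + gamma). The kept boxes have
    (alpha + q + gamma)-content O(eps / delta). The graph of an L-Lipschitz map
    meets O(1) cubes J over each I, so the part of the graph covered only by the
    discarded boxes projects to a set of measure O(delta). Borel-Cantelli along
    eps = delta^2 = 4^-m splits B into a [Gamma_alpha]-null set and an
    H^(alpha + q + gamma)-null set.

    Now choose a [Gamma_alpha]-null Borel set G minimizing dim (B \ G), which is
    possible because such sets are stable under countable unions. The splitting
    applied to B \ G shows dim (B \ G) <= alpha + beta'. The opposite inequality
    is Marstrand's: a cover of small (alpha + q)-sum has sections of small q-sum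
    for all t outside a set of small measure, by Chebyshev and the upper
    regularity of T. If B itself is [Gamma_alpha]-null, remove all of B except
    one point. *)
Require Import Defs.
From HB Require Import structures.
From mathcomp Require Import all_boot all_order all_algebra.
From mathcomp Require Import all_classical all_reals all_analysis.
From mathcomp Require Import measurable_realfun zify ring lra.
From Stdlib Require Cantor.
Set Implicit Arguments.
Unset Strict Implicit.
Unset Printing Implicit Defensive.
Import Order.TTheory GRing.Theory Num.Theory.
Import numFieldNormedType.Exports.
Local Open Scope classical_set_scope.
Local Open Scope ring_scope.

(** * Contents defined by countable covers and Hausdorff measures *)

Section Gauge.
Context {R : realType} {I Z : Type}.
Variables (ok : set I) (P : I -> set Z) (g : I -> \bar R).
Local Open Scope ereal_scope.
Implicit Types (A B : set Z) (s : nat -> I).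

(** Instantiated for the Hausdorff premeasures, for covers by balls and for the net capacity. Covers
    are infinite sequences of admissible pieces, so a finite cover has to be padded with pieces of
    zero or arbitrarily small cost. *)
Definition gauge_cover A s := A `<=` \bigcup_m P (s m) /\ forall m, ok (s m).

Definition gauge A : \bar R :=
  ereal_inf [set \sum_(0 <= m <oo) g (s m) | s in gauge_cover A].

Lemma gauge_le A s : gauge_cover A s -> gauge A <= \sum_(0 <= m <oo) g (s m).
Proof. by move=> As; apply: ereal_inf_lbound; exists s. Qed.

Lemma le_gauge A B : A `<=` B -> gauge A <= gauge B.
Proof.
move=> AB; apply: ereal_inf_le_tmp => x [s [Bs oks] <-].
by exists s => //; split => //; exact: subset_trans Bs.
Qed.

Hypothesis g_ge0 : forall i, 0 <= g i.

Lemma gauge_ge0 A : 0 <= gauge A.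
Proof.
by apply: le_ereal_inf_tmp => _ [s _ <-]; apply: nneseries_ge0.
Qed.

Lemma gauge_adherent A (e : R) : gauge A \is a fin_num -> (0 < e)%R ->
  exists2 s, gauge_cover A s & \sum_(0 <= m <oo) g (s m) < gauge A + e%:E.
Proof.
move=> Afin e0; have [x [s As <-] xA] := lb_ereal_inf_adherent e0 Afin.
by exists s.
Qed.

(** Nearly optimal covers of the [F n], with excess [e / 2 ^ n.+1], are merged into one sequence
    along a bijection between [nat] and [nat * nat]. *)
Lemma gauge_sigma_subadditive A (F : nat -> set Z) :
  A `<=` \bigcup_n F n -> gauge A <= \sum_(0 <= n <oo) gauge (F n).
Proof.
move=> AF; have [[n noo]|] := pselect (exists n, gauge (F n) = +oo).
  rewrite (eseries_pinfty _ _ noo) ?leey// => m _.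
  by rewrite -ltNye (lt_le_trans _ (gauge_ge0 _)).
rewrite -forallNE => Foo.
have Ffin n : gauge (F n) \is a fin_num.
  by rewrite ge0_fin_numE ?gauge_ge0// ltey; apply/eqP/Foo.
apply/lee_addgt0Pr => e e0.
apply: le_trans (epsilon_trick predT _ (ltW e0)); last first.
  by move=> n; exact: gauge_ge0.
have /choice[s sP] n : exists s, gauge_cover (F n) s /\
    \sum_(0 <= m <oo) g (s m) <= gauge (F n) + (e / (2 ^ n.+1)%:R)%:E.
  have en0 : (0 < e / (2 ^ n.+1)%:R)%R by rewrite divr_gt0// ltr0n expn_gt0.
  by have [s Fs sle] := gauge_adherent (Ffin n) en0; exists s; split => //; exact: ltW.
have /card_esym/ppcard_eqP[f] := card_nat2.
have covA : gauge_cover A (uncurry s \o f).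
  split=> [z /AF [n _] /(sP n).1.1 [m _ zP]|m].
    by exists (f^-1%FUN (n, m)) => //=; rewrite invK ?inE.
  by rewrite /=; case: (f m) => a b; exact: (sP a).1.2.
apply: (le_trans (gauge_le covA)).
have <- : \esum_(p in [set: nat * nat]) g (uncurry s p) =
    \sum_(0 <= m <oo) g ((uncurry s \o f) m).
  rewrite (reindex_esum setT setT f)//.
  by rewrite nneseries_esumT.
rewrite (_ : esum _ _ = \esum_(p in setT `*`` (fun=> setT)) g (s p.1 p.2)); last first.
  by congr esum; [apply/seteqP; split|apply/funext => -[]].
rewrite -(@esum_esum _ _ _ _ _ (fun n m => g (s n m)))// nneseries_esumT; last first.
  by move=> n; apply: adde_ge0; rewrite ?gauge_ge0// lee_fin divr_ge0// ?ler0n// ltW.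
apply: le_esum => n _; rewrite -nneseries_esumT//.
exact: (sP n).2.
Qed.

End Gauge.

Lemma nneseries_term_le {R : realType} (u : nat -> \bar R) (x : \bar R) i :
  (forall k, (0 <= u k)%E) -> (\sum_(0 <= k <oo) u k <= x)%E -> (u i <= x)%E.
Proof.
move=> u0; apply: le_trans; rewrite (nneseriesD1 (n := i))//.
by rewrite leeDl// nneseries_ge0.
Qed.

Section HausdorffMeasure.
Context {R : realType} {Z : Type}.
Variable d : Z -> Z -> R.
Local Open Scope ereal_scope.
Implicit Types (A B : set Z) (s delta : R).

Lemma diam_pow_ge0 s (E : set Z) : 0 <= diam_pow d s E.
Proof. by rewrite /diam_pow; case: pselect => [|] /= _ //; exact: poweR_ge0. Qed.

Lemma diam_pow0 s : diam_pow d s set0 = 0.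
Proof. by rewrite /diam_pow; case: (pselect (@set0 Z = set0)). Qed.

Lemma ediam0 : ediam d set0 = -oo.
Proof.
rewrite /ediam (_ : [set _ | _ in _] = set0) ?ereal_sup0//.
by apply/seteqP; split => // x [[? ?] [/=]].
Qed.

Lemma hpremeasureE delta s A : hpremeasure d delta s A =
  gauge [set E | ediam d E <= delta%:E] id (diam_pow d s) A.
Proof. by []. Qed.

Lemma le_hpremeasure delta s A B : A `<=` B ->
  hpremeasure d delta s A <= hpremeasure d delta s B.
Proof. by move=> AB; rewrite !hpremeasureE; exact: le_gauge. Qed.

Lemma hpremeasure_le delta s A (E : nat -> set Z) : hcover d delta A E ->
  hpremeasure d delta s A <= \sum_(0 <= i <oo) diam_pow d s (E i).
Proof.
by move=> AE; rewrite hpremeasureE; exact: (@gauge_le _ _ _ _ _ (diam_pow d s) _ E).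
Qed.

Lemma le_hpremeasure_delta delta1 delta2 s A : (delta1 <= delta2)%R ->
  hpremeasure d delta2 s A <= hpremeasure d delta1 s A.
Proof.
move=> le12; apply: ereal_inf_le_tmp => x [F [AF Fd] <-]; exists F => //.
by split => // i; rewrite (le_trans (Fd i))// lee_fin.
Qed.

Lemma hpremeasure_ge0 delta s A : 0 <= hpremeasure d delta s A.
Proof. by rewrite hpremeasureE; apply: gauge_ge0 => E; exact: diam_pow_ge0. Qed.

Lemma hpremeasure_le_hmeasure delta s A : (0 < delta)%R ->
  hpremeasure d delta s A <= hmeasure d s A.
Proof. by move=> d0; apply: ereal_sup_ubound; exists delta. Qed.

Lemma hmeasure_ge0 s A : 0 <= hmeasure d s A.
Proof.
exact: le_trans (hpremeasure_ge0 1 s A) (hpremeasure_le_hmeasure _ _ ltr01).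
Qed.

Lemma le_hmeasure s A B : A `<=` B -> hmeasure d s A <= hmeasure d s B.
Proof.
move=> AB; apply: ge_ereal_sup => _ [delta d0 <-].
by apply: (le_trans (le_hpremeasure _ _ AB)); exact: hpremeasure_le_hmeasure.
Qed.

Lemma hmeasure0 s : hmeasure d s set0 = 0.
Proof.
apply/eqP; rewrite eq_le hmeasure_ge0 andbT.
apply: ge_ereal_sup => _ [delta d0 <-].
apply: (@le_trans _ _ (\sum_(0 <= i <oo) diam_pow d s set0)).
  by apply: (@hpremeasure_le _ _ _ (fun=> set0)); split => //= _; rewrite ediam0 leNye.
by rewrite eseries0// => i _ _; rewrite diam_pow0.
Qed.

Lemma hmeasure_sigma_subadditive s : sigma_subadditive (hmeasure d s).
Proof.
move=> F; apply: ge_ereal_sup => _ [delta d0 <-].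
have := @gauge_sigma_subadditive _ _ _ [set E | ediam d E <= delta%:E] id
   _ (diam_pow_ge0 s) (\bigcup_n F n) F (@subset_refl _ _).
move/le_trans; apply; apply: lee_nneseries => n _; first by move=> _; apply: gauge_ge0 => ?; exact: diam_pow_ge0.
exact: hpremeasure_le_hmeasure.
Qed.

HB.instance Definition _ s := isOuterMeasure.Build R Z (hmeasure d s)
  (hmeasure0 s) (hmeasure_ge0 s) (le_hmeasure s) (@hmeasure_sigma_subadditive s).

(** A set of diameter at most [delta < rho] cannot meet both [A] and [B], so every cover of the
    union splits into a cover of [A] and one of [B]. *)
Lemma hpremeasure_separated delta s A B (rho : R) : (delta < rho)%R ->
  (forall a b, A a -> B b -> (rho <= d a b)%R) ->
  hpremeasure d delta s A + hpremeasure d delta s B <=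
  hpremeasure d delta s (A `|` B).
Proof.
move=> drho sepAB; apply: le_ereal_inf_tmp => _ [E [ABE Ed] <-].
(* Members of the cover that miss [C] become empty instead of being dropped; by the convention in
   [diam_pow] they cost 0 even when [s = 0]. *)
pose F (C : set Z) i := if pselect (E i `&` C = set0) then set0 else E i.
have FE C i : F C i = set0 \/ F C i = E i by rewrite /F; case: pselect; [left|right].
have Fcov C : C `<=` A `|` B -> hcover d delta C (F C).
  move=> CAB; split=> [x Cx|i]; last by case: (FE C i) => ->//; rewrite ediam0 leNye.
  have [i _ Eix] := ABE _ (CAB _ Cx); exists i => //.
  rewrite /F; case: pselect => // ECi0.
  by suff : (@set0 Z) x by []; rewrite -ECi0.
apply: (@le_trans _ _ (\sum_(0 <= i <oo) diam_pow d s (F A i) +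
    \sum_(0 <= i <oo) diam_pow d s (F B i))).
  by apply: leeD; apply: hpremeasure_le; apply: Fcov => x ?; [left|right].
rewrite -nneseriesD => [|i _ _|i _ _]; [|exact: diam_pow_ge0..].
apply: lee_nneseries => i _; first by rewrite adde_ge0// diam_pow_ge0.
have [E0|[a [Ea Aa]]] : E i `&` A = set0 \/ exists a, E i a /\ A a.
- by have [|/set0P[a ?]] := eqVneq (E i `&` A) set0; [left|right; exists a].
- rewrite (_ : F A i = set0); last by rewrite /F; case: pselect.
  rewrite diam_pow0 add0e.
  by case: (FE B i) => ->//; rewrite diam_pow0 diam_pow_ge0.
rewrite [X in _ + X](_ : _ = 0).
  by rewrite adde0; case: (FE A i) => ->//; rewrite diam_pow0 diam_pow_ge0.
suff -> : F B i = set0 by rewrite diam_pow0.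
rewrite /F; case: pselect => // EB; exfalso; apply: EB.
apply/seteqP; split => // b [Eb Bb].
suff : (rho%:E <= delta%:E) by rewrite lee_fin leNgt drho.
apply: le_trans (Ed i); apply: (@le_trans _ _ (d a b)%:E).
  by rewrite lee_fin sepAB.
by apply: ereal_sup_ubound; exists (a, b).
Qed.

Lemma hmeasure_separated s A B (rho : R) : (0 < rho)%R ->
  (forall a b, A a -> B b -> (rho <= d a b)%R) ->
  hmeasure d s (A `|` B) = hmeasure d s A + hmeasure d s B.
Proof.
move=> rho0 sepAB; apply/eqP; rewrite eq_le outer_measureU2/=.
have [->|hfin] := eqVneq (hmeasure d s (A `|` B)) +oo; first by rewrite leey.
have fin C : C `<=` A `|` B -> hmeasure d s C \is a fin_num.
  move=> CAB; rewrite ge0_fin_numE ?hmeasure_ge0//.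
  by rewrite (le_lt_trans (le_hmeasure s CAB))// ltey.
have hfin' := fin _ (@subset_refl _ (A `|` B)).
have Afin := fin A (@subsetUl _ A B).
rewrite -leeBrDl//; apply: ge_ereal_sup => _ [d2 /= d20 <-].
have Bfin : hpremeasure d d2 s B \is a fin_num.
  rewrite ge0_fin_numE ?hpremeasure_ge0// (le_lt_trans (hpremeasure_le_hmeasure _ _ d20))//.
  by rewrite -ge0_fin_numE ?hmeasure_ge0// fin// => x; right.
rewrite leeBrDl// addeC -leeBrDl//; apply: ge_ereal_sup => _ [d1 /= d10 <-].
rewrite leeBrDl// addeC.
(* Below [d1] and [d2], so that both premeasures can only increase, and below [rho], so that the
   separation applies. *)
pose delta := Num.min (Num.min d1 d2) (rho / 2)%R.
have delta0 : (0 < delta)%R by rewrite !lt_min d10 d20 divr_gt0.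
apply: (@le_trans _ _ (hpremeasure d delta s A + hpremeasure d delta s B)).
  by apply: leeD; apply: le_hpremeasure_delta; rewrite !ge_min lexx ?orbT.
apply: le_trans (hpremeasure_le_hmeasure s _ delta0).
apply: (@hpremeasure_separated delta s A B rho) => //.
by rewrite /delta gt_min ltr_pdivrMr// ltr_pMr// ltr1n orbT.
Qed.

End HausdorffMeasure.

Lemma open_ball_sub {R : realType} {V : normedModType R} (U : set V) (x : V) :
  open U -> U x -> exists r : R, 0 < r /\ ball x r `<=` U.
Proof.
move=> oU Ux; have := open_subball oU Ux => h.
by near (0 : R)^'+ => r; exists r; split=> //; near: r.
Unshelve. all: by end_near. Qed.

Lemma closed_dist_le {R : realType} {V : normedModType R} (x : V) (r : R) :
  closed [set y | `|x - y| <= r].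
Proof.
rewrite (_ : [set y | _] = (fun y => `|x - y|) @^-1` [set z | z <= r])//.
apply: closed_comp => [y _|]; last exact: closed_le.
by apply: cvg_norm; apply: cvgB; [exact: cvg_cst|exact: cvg_id].
Qed.

(** * Measurability of open sets for metric outer measures *)

Section MetricOuterMeasure.
Context {R : realType} {V : normedModType R}.
Variable mu : {outer_measure set V -> \bar R}.
Local Open Scope ereal_scope.

Hypothesis mu_separated : forall (A B : set V) (rho : R), (0 < rho)%R ->
  (forall a b, A a -> B b -> (rho <= `|a - b|)%R) -> mu (A `|` B) = mu A + mu B.

(* The layers [D n] at distance about 1/n from the complement of [U] are
   separated once two apart, so [mu (A n.+2) >= mu (A n) + mu (D n.+1)] and
   their measures are summable. *)
Lemma metric_outer_measure_open (U : set V) : open U -> mu.-caratheodory U.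
Proof.
move=> oU; apply: le_caratheodory_measurable => X.
have [->|Xoo] := eqVneq (mu X) +oo; first by rewrite leey.
have Xfin : mu X \is a fin_num by rewrite ge0_fin_numE ?outer_measure_ge0// ltey.
pose A n := [set x | (X `&` U) x /\ forall y, ~ U y -> (n.+1%:R^-1 <= `|x - y|)%R].
pose D n := A n.+1 `\` A n.
have AXU n : A n `<=` X `&` U by move=> x [].
have AS n : A n `<=` A n.+1.
  move=> x [XUx Ax]; split=> // y /Ax; apply: le_trans.
  by rewrite lef_pV2 ?posrE// ler_nat.
have sepA n (B : set V) : (forall x, B x -> (X `&` U) x /\ ~ A n.+1 x) ->
    mu (A n `|` B) = mu (A n) + mu B.
  move=> BD; apply: (@mu_separated _ _ (n.+1%:R^-1 - n.+2%:R^-1)).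
    by rewrite subr_gt0 ltf_pV2 ?posrE// ltr_nat.
  move=> a b [_ Aa] /BD[XUb nAb].
  have [y [nUy yb]] : exists y, ~ U y /\ (`|b - y| < n.+2%:R^-1)%R.
    apply: contrapT => /forallNP h; apply: nAb; split => // y nUy.
    by rewrite leNgt; apply/negP => lt; apply: (h y).
  rewrite lerBlDr (le_trans (Aa y nUy))// (le_trans (ler_distD b _ _))//.
  by rewrite lerD2l ltW.
have a_le n : mu (A n) + mu (X `&` ~` U) <= mu X.
  rewrite -(@mu_separated _ _ n.+1%:R^-1) ?invr_gt0//.
    by apply: le_outer_measure => x [/AXU[]|[]].
  by move=> a b [_ Aa] [_ /Aa].
have afin n : mu (A n) \is a fin_num.
  rewrite ge0_fin_numE ?outer_measure_ge0// (@le_lt_trans _ _ (mu X)) ?ltey//.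
  by apply: le_trans (a_le n); rewrite leeDl ?outer_measure_ge0.
have step n : mu (A n) + mu (D n.+1) <= mu (A n.+2).
  rewrite -sepA => [|x [/AXU]//]; apply: le_outer_measure => x [/AS/AS//|[]//].
(* Even and odd layers telescope separately, which accounts for the two terms on the right. *)
have sumD N : \sum_(0 <= n < N) mu (D n.+1) <= mu (A N) + mu (A N.+1).
  elim: N => [|N IH]; first by rewrite big_nil adde_ge0 ?outer_measure_ge0.
  rewrite big_nat_recr//= (le_trans (leeD2r _ IH))//.
  by rewrite addeAC addeC leeD2l.
have Dfin : \sum_(0 <= n <oo) mu (D n) < +oo.
  rewrite nneseries_recl//.
  apply: lte_add_pinfty.
    rewrite (@le_lt_trans _ _ (mu (A 1%N)))//; last by rewrite -ge0_fin_numE ?outer_measure_ge0.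
    by apply: le_outer_measure => x [].
  rewrite -(nneseries_addn 1); last by move=> n; exact: outer_measure_ge0.
  apply: (@le_lt_trans _ _ (mu X + mu X)); last by rewrite lte_add_pinfty// ltey.
  apply: lime_le; first by apply: is_cvg_nneseries => n _ _; exact: outer_measure_ge0.
  near=> N; under eq_bigr do rewrite addn1.
  apply: (le_trans (sumD N)); apply: leeD; apply: le_outer_measure => x.
    by move=> /AXU[].
  by move=> /AXU[].
apply/lee_addgt0Pr => e e0.
have [N tailN] : exists N, \sum_(N <= k <oo) mu (D k) <= e%:E.
  have /fine_cvgP[fin0] := nneseries_tail_cvg Dfin (fun k _ => outer_measure_ge0 mu (D k)).
  move=> /cvgr_le/(_ _ e0) tailN.
  near \oo => N; exists N.
  have finN : \sum_(N <= k <oo) mu (D k) \is a fin_num by near: N.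
  by rewrite -(fineK finN) lee_fin; near: N.
have XUA : X `&` U `<=` A N `|` \bigcup_(k in ~` `I_N) D k.
  move=> x XUx; have [n [Nn Anx]] : exists n, (N <= n)%N /\ A n x.
    have [r [r0 rU]] := open_ball_sub oU XUx.2.
    have [m _ hm] := near_infty_natSinv_lt (PosNum r0).
    exists (maxn N m); split; first exact: leq_maxl.
    split => // y nUy; rewrite leNgt; apply/negP => xy; apply: nUy; apply: rU.
    rewrite -ball_normE /= (lt_trans xy)// (le_lt_trans _ (hm m _))//=.
    by rewrite lef_pV2 ?posrE// ler_nat ltnS leq_maxr.
  elim: n Nn Anx => [|n IH]; first by rewrite leqn0 => /eqP ->; left.
  rewrite leq_eqVlt => /predU1P[->|]; first by left.
  rewrite ltnS => Nn Anx; have [Anx'|nAnx] := pselect (A n x); first exact: IH.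
  by right; exists n => //=; rewrite /= ltnNge Nn.
apply: (le_trans (leeD2r _ (le_outer_measure _ _ _ XUA))).
apply: (le_trans (leeD2r _ (outer_measureU2 _ _ _))).
rewrite addeAC leeD ?a_le//.
by apply: le_trans tailN; exact: outer_measure_sigma_subadditive_tail.
Unshelve. all: by end_near. Qed.

End MetricOuterMeasure.

Section RealPowers.
Context {R : realType}.
Implicit Types a b s r : R.

Lemma powR_le_base s a b : 0 <= s -> 0 <= a -> a <= b -> a `^ s <= b `^ s.
Proof.
move=> s0 a0 ab; apply: ge0_ler_powR => //; rewrite nnegrE//.
exact: le_trans ab.
Qed.

Lemma powR_lt_base s a b : 0 < s -> 0 <= a -> a < b -> a `^ s < b `^ s.
Proof.
move=> s0 a0 ab; apply: gt0_ltr_powR => //; rewrite nnegrE//.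
exact: le_trans (ltW ab).
Qed.

Lemma powR_ltI s a b : 0 <= s -> 0 <= b -> a `^ s < b `^ s -> a < b.
Proof.
move=> s0 b0; rewrite !ltNge; apply: contra => ba.
exact: powR_le_base.
Qed.

Lemma powRVK s a : 0 < s -> 0 <= a -> (a `^ s^-1) `^ s = a.
Proof. by move=> s0 a0; rewrite -powRrM mulVf ?gt_eqF// powRr1. Qed.

End RealPowers.

(** * Null sets through covers by balls *)

Section BallNull.
Context {R : realType} {V : normedModType R}.
Implicit Types (A : set V) (s : R).
Local Open Scope ereal_scope.

(* Balls are those of the maximum norm: up to a constant factor they compute
   the same content as covers by sets of small Euclidean diameter. *)
Definition ball_gauge s A : \bar R :=
  gauge [set p : V * R | (0 < p.2)%R] (fun p => ball p.1 p.2)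
    (fun p => (p.2 `^ s)%:E) A.

Definition ball_null s A := ball_gauge s A = 0.

Lemma powR_EFin_ge0 s (p : V * R) : 0 <= (p.2 `^ s)%:E.
Proof. by rewrite lee_fin powR_ge0. Qed.

Lemma ball_gauge_ge0 s A : 0 <= ball_gauge s A.
Proof. by apply: gauge_ge0; exact: powR_EFin_ge0. Qed.

Lemma ball_gauge_bigcup s (F : nat -> set V) :
  ball_gauge s (\bigcup_n F n) <= \sum_(0 <= n <oo) ball_gauge s (F n).
Proof.
exact: (@gauge_sigma_subadditive _ _ _ _ _ _ (powR_EFin_ge0 s) _ F (@subset_refl _ _)).
Qed.

Lemma ball_nullP s A : ball_null s A <-> forall e : R, (0 < e)%R ->
  exists x : nat -> V, exists r : nat -> R, [/\ forall i, (0 < r i)%R,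
    A `<=` \bigcup_i ball (x i) (r i) &
    \sum_(0 <= i <oo) (r i `^ s)%:E <= e%:E].
Proof.
split=> [A0 e e0|h].
  have [|c [Ac c0] cA] := @gauge_adherent _ _ _ [set p : V * R | (0 < p.2)%R]
     (fun p => ball p.1 p.2) (fun p => (p.2 `^ s)%:E) A e _ e0.
    by rewrite [gauge _ _ _ _]A0.
  exists (fun i => (c i).1), (fun i => (c i).2); split => //.
  by rewrite [gauge _ _ _ _]A0 add0e in cA; exact: ltW.
apply/eqP; rewrite eq_le ball_gauge_ge0 andbT.
apply/lee_addgt0Pr => e /h[x [r [r0 Axr xre]]]; rewrite add0e.
by apply: le_trans xre; apply: (@gauge_le _ _ _ _ _ _ _ (fun i => (x i, r i))).
Qed.

Lemma ball_null_sub s A (B : set V) : A `<=` B -> ball_null s B -> ball_null s A.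
Proof.
move=> AB B0; apply/eqP; rewrite eq_le ball_gauge_ge0 andbT.
by rewrite -B0; exact: le_gauge.
Qed.

Lemma ball_null_bigcup s (F : nat -> set V) :
  (forall n, ball_null s (F n)) -> ball_null s (\bigcup_n F n).
Proof.
move=> F0; apply/eqP; rewrite eq_le ball_gauge_ge0 andbT.
apply: (le_trans (ball_gauge_bigcup s F)).
by rewrite eseries0// => i _ _; exact: F0.
Qed.

(** A cover of total cost at most 1 has all its radii at most 1, so raising the exponent lowers its
    cost. *)
Lemma ball_null_exp s s' A : (0 < s)%R -> (s <= s')%R ->
  ball_null s A -> ball_null s' A.
Proof.
move=> s0 ss' /ball_nullP A0; apply/ball_nullP => e e0.
have [|x [r [r0 Axr xre]]] := A0 (Num.min e 1%R); first by rewrite lt_min e0 ltr01.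
exists x, r; split => //.
have r1 i : (r i <= 1)%R.
  have : (r i `^ s <= 1)%R.
    rewrite -lee_fin; apply: le_trans (nneseries_term_le i _ xre) _.
      by move=> k; rewrite lee_fin powR_ge0.
    by rewrite lee_fin ge_min lexx orbT.
  apply: contraTT; rewrite -!ltNge => r1; have := powR_lt_base s0 ler01 r1.
  by rewrite powR1.
apply: (@le_trans _ _ (\sum_(0 <= i <oo) (r i `^ s)%:E)).
  apply: lee_nneseries => i _; first by rewrite lee_fin powR_ge0.
  by rewrite lee_fin ger_powR// r0 r1.
by apply: (le_trans xre); rewrite lee_fin ge_min lexx.
Qed.

End BallNull.

Section HausdorffNull.
Context {R : realType} {V : normedModType R}.
Variables (d : V -> V -> R) (C : R).
Hypothesis d_ge : forall x y, `|x - y| <= d x y.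
Hypothesis d_le : forall x y, d x y <= C * `|x - y|.
Hypothesis C_gt0 : 0 < C.
Local Open Scope ereal_scope.
Implicit Types (A : set V) (s : R).

Lemma norm_ediam A (x y : V) : A x -> A y -> (`|x - y|)%:E <= ediam d A.
Proof.
move=> Ax Ay; apply: (@le_trans _ _ (d x y)%:E); first by rewrite lee_fin.
by apply: ereal_sup_ubound; exists (x, y).
Qed.

Lemma ediam_ge0 A : A !=set0 -> 0 <= ediam d A.
Proof. by move=> [x Ax]; rewrite (le_trans _ (norm_ediam Ax Ax))// lee_fin. Qed.

Lemma ediam_ball (x : V) (r : R) : ediam d (ball x r) <= (2 * C * r)%:E.
Proof.
apply: ge_ereal_sup => ? [[y z] /= [+ +] <-]; rewrite -ball_normE /= => xy xz.
rewrite lee_fin (le_trans (d_le _ _))// -mulrA (mulrCA 2%R) ler_pM2l// mulr_natl mulr2n.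
by rewrite (le_trans (ler_distD x _ _))// lerD// ?(ltW xz)// distrC ltW.
Qed.

Lemma diam_powE s A : A !=set0 -> diam_pow d s A = ediam d A `^ s.
Proof. by move=> /set0P/eqP A0; rewrite /diam_pow; case: pselect. Qed.

Lemma diam_pow_le s (r : R) A : A !=set0 -> (0 <= s)%R -> ediam d A <= r%:E ->
  diam_pow d s A <= (r `^ s)%:E.
Proof.
move=> A0 s0 Ar; rewrite diam_powE//.
have Di : ediam d A = (fine (ediam d A))%:E.
  by rewrite fineK// ge0_fin_numE ?ediam_ge0// (le_lt_trans Ar)// ltey.
move: Ar; rewrite Di poweR_EFin !lee_fin; apply: powR_le_base => //.
by rewrite fine_ge0 ?ediam_ge0.
Qed.

(** Any cover of a point has a nonempty member, which costs 1 at exponent 0. *)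
Lemma hmeasure0_eq0 A : hmeasure d 0 A = 0 -> A = set0.
Proof.
move=> A0; apply/seteqP; split=> // a Aa; exfalso.
suff : (1%:E : \bar R) <= hmeasure d 0 A by rewrite A0 lee_fin ler10.
apply: le_trans (hpremeasure_le_hmeasure _ _ _ ltr01).
apply: le_ereal_inf_tmp => _ [E [AE _] <-].
have [i _ Eia] := AE _ Aa.
have -> : 1%:E = diam_pow d 0 (E i).
  by rewrite diam_powE ?poweRe0//; exists a.
by apply: (@nneseries_term_le _ (fun i => diam_pow d 0 (E i)) _ i) => // k; exact: diam_pow_ge0.
Qed.

(** Each nonempty member of a cover lies in a ball centred at one of its points, of radius slightly
    above its diameter. The premeasure at scale 1 is enough, since [ball_null] does not restrict the
    radii. *)
Lemma hmeasure_ball_null s A : (0 < s)%R -> hmeasure d s A = 0 -> ball_null s A.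
Proof.
move=> s0 A0; apply/ball_nullP => e e0.
have e20 : (0 < e / 2)%R by rewrite divr_gt0.
have pre0 : hpremeasure d 1 s A = 0.
  apply/eqP; rewrite eq_le hpremeasure_ge0 andbT -A0.
  exact: hpremeasure_le_hmeasure.
have [|E [AE Ed]] := @gauge_adherent _ _ _ [set E | ediam d E <= 1%:E] id
  (diam_pow d s) A _ _ e20; first by rewrite -hpremeasureE pre0.
rewrite -hpremeasureE pre0 add0e => Ee.
have Dfin i : diam_pow d s (E i) \is a fin_num.
  rewrite ge0_fin_numE ?diam_pow_ge0//.
  apply: (le_lt_trans (@nneseries_term_le _ (fun i => diam_pow d s (E i)) _ i _ (ltW Ee))).
    by move=> k; exact: diam_pow_ge0.
  by rewrite ltey.
pose D i := fine (diam_pow d s (E i)).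
have D0 i : (0 <= D i)%R by rewrite fine_ge0 ?diam_pow_ge0.
(* The [s]-th power of the radius. The surplus keeps the radius positive when the diameter is 0, and
   lets the open ball contain points at a distance equal to the diameter. *)
pose t i := (D i + (e / 2) / (2 ^ i.+1)%:R)%R.
have t0 i : (0 < t i)%R by rewrite ltr_wpDl// divr_gt0// ltr0n expn_gt0.
have /choice[x xP] i : exists x, E i !=set0 -> E i x.
  by have [[x Ex]|nE] := pselect (E i !=set0); [exists x|exists 0%R].
exists x, (fun i => t i `^ s^-1)%R; split.
- by move=> i; rewrite powR_gt0.
- move=> a /AE[i _ /= Eia]; exists i => //.
  have E0 : E i !=set0 by exists a.
  have Di : ediam d (E i) = (fine (ediam d (E i)))%:E.
    by rewrite fineK// ge0_fin_numE ?ediam_ge0// (le_lt_trans (Ed i))// ltey.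
  have := norm_ediam (xP i E0) Eia; rewrite Di lee_fin => xa.
  rewrite -ball_normE /= (le_lt_trans xa)//.
  apply: (@powR_ltI _ s); [exact: ltW|exact: powR_ge0|].
  rewrite powRVK// ?(ltW (t0 i))// /t /D diam_powE// Di poweR_EFin /=.
  by rewrite ltrDl divr_gt0// ltr0n expn_gt0.
- under eq_eseriesr do rewrite powRVK// ?(ltW (t0 _))// /t EFinD.
  apply: (le_trans (epsilon_trick _ _ _)) => [i|//|].
  + by rewrite lee_fin.
  + exact: ltW.
  rewrite [X in _ <= X](_ : _ = (e / 2)%:E + (e / 2)%:E); last by rewrite -EFinD -splitr.
  rewrite leeD2r// (le_trans _ (ltW Ee))//.
  by apply: lee_nneseries => i _; rewrite ?lee_fin// /D fineK.
Qed.

(** A small total cost forces small radii, so the covers of [ball_null] become admissible for every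
    [delta]. *)
Lemma ball_null_hmeasure s A : (0 < s)%R -> ball_null s A -> hmeasure d s A = 0.
Proof.
move=> s0 /ball_nullP A0; apply/eqP; rewrite eq_le hmeasure_ge0 andbT.
apply: ge_ereal_sup => _ [delta /= d0 <-].
apply/lee_addgt0Pr => e e0; rewrite add0e.
have C20 : (0 < 2 * C)%R by rewrite mulr_gt0.
(* The first bound absorbs the factor from radius to diameter in the total cost; the second forces
   every diameter to be at most [delta]. *)
pose e' : R := Num.min (e / (2 * C) `^ s)%R ((delta / (2 * C)) `^ s)%R.
have e'0 : (0 < e')%R by rewrite lt_min divr_gt0 ?powR_gt0// divr_gt0.
have [x [r [r0 Axr xre]]] := A0 _ e'0.
have rd i : (2 * C * r i <= delta)%R.
  rewrite -ler_pdivlMl// mulrC leNgt; apply/negP => lt.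
  have : (r i `^ s <= (delta / (2 * C)) `^ s)%R.
    rewrite -lee_fin; apply: le_trans (nneseries_term_le i _ xre) _.
      by move=> k; rewrite lee_fin powR_ge0.
    by rewrite lee_fin ge_min lexx orbT.
  by rewrite leNgt powR_lt_base// divr_ge0 ?ltW.
apply: (@le_trans _ _ (\sum_(0 <= i <oo) diam_pow d s (ball (x i) (r i)))).
  apply: hpremeasure_le; split => // i.
  by rewrite (le_trans (ediam_ball _ _))// lee_fin.
apply: (@le_trans _ _ (\sum_(0 <= i <oo) ((2 * C) `^ s)%:E * (r i `^ s)%:E)).
  apply: lee_nneseries => i _; first by move=> _; exact: diam_pow_ge0.
  have b0 : ball (x i) (r i) !=set0 by exists (x i); exact: ballxx.
  apply: (le_trans (diam_pow_le b0 (ltW s0) (ediam_ball (x i) (r i)))).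
  by rewrite powRM ?EFinM// ltW.
rewrite nneseriesZl => [|i _]; last by rewrite lee_fin powR_ge0.
rewrite muleC -lee_pdivlMr ?powR_gt0// (le_trans xre)// -EFinM lee_fin.
by rewrite ge_min mulrC lexx.
Qed.

(** For sets of diameter at most [delta], the [s]-th power of the diameter is at most
    [delta ^ (s - a)] times its [a]-th power, and this factor tends to 0. *)
Lemma hmeasure_exp_null a s A : (0 <= a)%R -> (a < s)%R ->
  hmeasure d a A < +oo -> hmeasure d s A = 0.
Proof.
move=> a0 as_ Afin; apply/eqP; rewrite eq_le hmeasure_ge0 andbT.
have hfin : hmeasure d a A \is a fin_num by rewrite ge0_fin_numE ?hmeasure_ge0.
pose M := (fine (hmeasure d a A) + 1)%R.
have M0 : (0 < M)%R by rewrite ltr_wpDl// fine_ge0// hmeasure_ge0.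
have key (delta : R) : (0 < delta)%R ->
    hpremeasure d delta s A <= (delta `^ (s - a) * M)%:E.
  move=> d0.
  have preM : hpremeasure d delta a A < M%:E.
    apply: (le_lt_trans (hpremeasure_le_hmeasure d a A d0)).
    by rewrite -(fineK hfin) lte_fin ltrDl.
  have [_ [E [AE Ed] <-] EM] := ereal_inf_lt preM.
  apply: (@le_trans _ _ (\sum_(0 <= i <oo) (delta `^ (s - a))%:E * diam_pow d a (E i))).
    apply: (le_trans (hpremeasure_le _ (conj AE Ed))).
    apply: lee_nneseries => i _; first by move=> _; exact: diam_pow_ge0.
    have [->|/set0P E0] := eqVneq (E i) set0; first by rewrite !diam_pow0 mule0.
    rewrite !diam_powE//.
    have Di : ediam d (E i) = (fine (ediam d (E i)))%:E.
      by rewrite fineK// ge0_fin_numE ?ediam_ge0// (le_lt_trans (Ed i))// ltey.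
    have D0 : (0 <= fine (ediam d (E i)))%R by rewrite fine_ge0 ?ediam_ge0.
    have := Ed i; rewrite Di lee_fin => Dd.
    rewrite !poweR_EFin -EFinM lee_fin -{1}(subrK a s) [in leLHS]powRD; last first.
      by rewrite subrK (gt_eqF (le_lt_trans a0 as_)).
    by rewrite ler_wpM2r ?powR_ge0// powR_le_base// subr_ge0 ltW.
  rewrite nneseriesZl => [|i _]; last exact: diam_pow_ge0.
  by rewrite EFinM lee_pmul2l ?fin_numE// ?lte_fin ?powR_gt0// ltW.
apply: ge_ereal_sup => _ [delta /= d0 <-].
apply/lee_addgt0Pr => e e0; rewrite add0e.
have sa0 : (0 < s - a)%R by rewrite subr_gt0.
pose eta := ((e / M) `^ (s - a)^-1)%R.
have eta0 : (0 < eta)%R by rewrite powR_gt0// divr_gt0.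
have min0 : (0 < Num.min delta eta)%R by rewrite lt_min d0.
have min_le : (Num.min delta eta <= delta)%R by rewrite ge_min lexx.
apply: (le_trans (le_hpremeasure_delta d s A min_le)).
apply: (le_trans (key _ min0)); rewrite lee_fin -ler_pdivlMr//.
rewrite -[leRHS](powRVK sa0 (ltW (divr_gt0 e0 M0))).
by apply: powR_le_base; [exact: ltW..|rewrite ge_min lexx orbT].
Qed.

Lemma hdim_le s A : (0 <= s)%R -> hmeasure d s A = 0 -> hdim d A <= s%:E.
Proof. by move=> s0 A0; apply: ereal_inf_lbound; exists s. Qed.

Lemma hdim_lt_null s A : hdim d A < s%:E -> hmeasure d s A = 0.
Proof.
move=> /ereal_inf_lt[_ [t [t0 At] <-]]; rewrite lte_fin => ts.
(* Exponents are compared through ball covers, which requires a positive exponent; nullity at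
   exponent 0 means that the set is empty. *)
move: t0; rewrite le_eqVlt => /predU1P[t0|t0].
  by rewrite -t0 in At; rewrite (hmeasure0_eq0 At) hmeasure0.
apply: ball_null_hmeasure; first exact: lt_trans ts.
by apply: (ball_null_exp t0 (ltW ts)); exact: hmeasure_ball_null.
Qed.

Lemma hdim_ge0 A : 0 <= hdim d A.
Proof. by apply: le_ereal_inf_tmp => _ [s [s0 _] <-]; rewrite lee_fin. Qed.

Lemma hdim_le_approx s A : (0 <= s)%R ->
  (forall t, (s < t)%R -> hmeasure d t A = 0) -> hdim d A <= s%:E.
Proof.
move=> s0 h; apply/lee_addgt0Pr => e e0; rewrite -EFinD; apply: hdim_le.
  by rewrite addr_ge0// ltW.
by apply: h; rewrite ltrDl.
Qed.

Lemma le_hdim A (B : set V) : A `<=` B -> hdim d A <= hdim d B.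
Proof.
move=> AB; apply: ereal_inf_le_tmp => _ [s [s0 Bs] <-]; exists s => //; split=> //.
by apply/eqP; rewrite eq_le hmeasure_ge0 andbT -Bs; exact: le_hmeasure.
Qed.

Lemma hdim_set1 (x : V) : hdim d [set x] = 0.
Proof.
apply/eqP; rewrite eq_le hdim_ge0 andbT; apply: hdim_le_approx => // t t0.
apply: ball_null_hmeasure => //; apply/ball_nullP => e e0.
exists (fun=> x), (fun i => ((e / (2 ^ i.+1)%:R) `^ t^-1)%R).
have ei0 i : (0 < e / (2 ^ i.+1)%:R)%R by rewrite divr_gt0// ltr0n expn_gt0.
split=> [i|_ ->|]; first by rewrite powR_gt0.
  by exists 0%N => //; apply: ballxx; rewrite powR_gt0.
under eq_eseriesr do rewrite powRVK ?(ltW (ei0 _))//.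
exact: (epsilon_trick0 predT (ltW e0)).
Qed.

End HausdorffNull.

(** * Comparison of Euclidean distances with maximum norms *)

Section EuclideanDistances.
Context {R : realType}.

Lemma mx_norm_coord n (x : 'rV[R]_n) i : `|x 0 i| <= `|x|.
Proof.
rewrite [leRHS]mx_normrE.
by apply: (@le_bigmax _ _ _ _ (fun ij : 'I_1 * 'I_n => `|x ij.1 ij.2|) (0, i)).
Qed.

Lemma mx_norm_leP n (x : 'rV[R]_n) (a : R) : 0 <= a ->
  (forall i, `|x 0 i| <= a) -> `|x| <= a.
Proof.
move=> a0 xa; rewrite [leLHS]mx_normrE; apply/bigmax_leP; split => // -[i j] _ /=.
by rewrite (ord1 i).
Qed.

Lemma edistv_ge n (x y : 'rV[R]_n) : `|x - y| <= edistv x y.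
Proof.
apply: mx_norm_leP => [|i]; first exact: sqrtr_ge0.
rewrite -sqrtr_sqr ler_wsqrtr// !mxE (bigD1 i)//= lerDl.
by apply: sumr_ge0 => j _; exact: sqr_ge0.
Qed.

Lemma edistv_le n (x y : 'rV[R]_n) : edistv x y <= (n%:R + 1) * `|x - y|.
Proof.
have xy0 : 0 <= (n%:R + 1) * `|x - y| by rewrite mulr_ge0.
rewrite -[leRHS]ger0_norm// -sqrtr_sqr ler_wsqrtr//.
apply: (@le_trans _ _ (\sum_(i < n) `|x - y| ^+ 2)).
  apply: ler_sum => i _; rewrite -real_normK ?num_real// lerXn2r ?nnegrE//.
  by have := mx_norm_coord (x - y) i; rewrite !mxE.
rewrite sumr_const card_ord exprMn -[leLHS]mulr_natl ler_wpM2r ?sqr_ge0//.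
rewrite (@le_trans _ _ (n%:R + 1))// ?lerDl// expr2 ler_peMl ?addr_ge0//.
by rewrite lerDr.
Qed.

Lemma edistp_ge k n (p q : 'rV[R]_k * 'rV[R]_n) : `|p - q| <= edistp p q.
Proof.
rewrite [leLHS]prod_normE ge_max; apply/andP; split.
  apply: (le_trans (edistv_ge _ _)); rewrite -[leLHS]ger0_norm ?sqrtr_ge0//.
  by rewrite -sqrtr_sqr ler_wsqrtr// lerDl sqr_ge0.
apply: (le_trans (edistv_ge _ _)); rewrite -[leLHS]ger0_norm ?sqrtr_ge0//.
by rewrite -sqrtr_sqr ler_wsqrtr// lerDr sqr_ge0.
Qed.

Lemma edistp_le k n (p q : 'rV[R]_k * 'rV[R]_n) :
  edistp p q <= (k%:R + 1 + (n%:R + 1)) * `|p - q|.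
Proof.
have d0 := sqrtr_ge0; apply: (@le_trans _ _ (edistv p.1 q.1 + edistv p.2 q.2)).
  rewrite -[leRHS]ger0_norm ?addr_ge0 ?sqrtr_ge0// -sqrtr_sqr ler_wsqrtr//.
  by rewrite sqrrD addrAC lerDl mulrn_wge0// mulr_ge0 ?sqrtr_ge0.
rewrite mulrDl lerD// (le_trans (edistv_le _ _))// ler_wpM2l//.
  by rewrite [leRHS]prod_normE le_max lexx.
by rewrite [leRHS]prod_normE le_max lexx orbT.
Qed.

End EuclideanDistances.

(** * Integrated net contents *)

Section NetCapacity.
Context d (X : measurableType d) (R : realType) (mu : {measure set X -> \bar R}).
Context (Y : Type) (D : nat -> set Y) (lev : nat -> nat) (w : nat -> R).
Hypothesis D_nested : forall i j y, D i y -> D j y -> (lev i <= lev j)%N ->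
  D j `<=` D i.
Hypothesis w_ge0 : forall i, 0 <= w i.
Local Open Scope ereal_scope.
Implicit Types (A : set (X * Y)) (e : nat -> set X).

(* [p = (E, i)] encodes the product set [E `*` D i]; a cover gives to each point
   of [X] its own family of cells, measurably. *)
Definition net_cap A : \bar R :=
  gauge [set p : set X * nat | measurable p.1] (fun p => p.1 `*` D p.2)
    (fun p => (w p.2)%:E * mu p.1) A.

Lemma net_cost_ge0 (p : set X * nat) : 0 <= (w p.2)%:E * mu p.1.
Proof. by rewrite mule_ge0// lee_fin. Qed.

Definition fam_cover e : set (X * Y) := [set z | exists i, e i z.1 /\ D i z.2].

Definition fam_cost e : \bar R := \sum_(0 <= i <oo) (w i)%:E * mu (e i).

Lemma net_cap_le_fam A e : (forall i, measurable (e i)) -> A `<=` fam_cover e ->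
  net_cap A <= fam_cost e.
Proof.
move=> me Ae; apply: (@gauge_le _ _ _ _ _ _ _ (fun i => (e i, i))).
by split=> // z /Ae[i ?]; exists i.
Qed.

(** All boxes over the same cell are merged by taking the union of their bases; by subadditivity of
    [mu] this does not increase the cost. *)
Lemma net_cap_family A (r : \bar R) : net_cap A < r ->
  exists e, [/\ forall i, measurable (e i), A `<=` fam_cover e & fam_cost e <= r].
Proof.
move=> /ereal_inf_lt[_ [s [As ms] <-] sr].
pose E i m := if (s m).2 == i then (s m).1 else set0.
have mE i m : measurable (E i m) by rewrite /E; case: ifP => // _; exact: ms.
exists (fun i => \bigcup_m E i m); split.
- by move=> i; apply: bigcup_measurable => m _.
- move=> z /As[m _ [smz Dz]]; exists (s m).2; split => //.
  by exists m => //; rewrite /E eqxx.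
apply: le_trans (ltW sr).
apply: (@le_trans _ _ (\sum_(0 <= i <oo) \sum_(0 <= m <oo) (w i)%:E * mu (E i m))).
  apply: lee_nneseries => i _; first by move=> _; rewrite mule_ge0// lee_fin.
  rewrite nneseriesZl//; apply: lee_wpmul2l; first by rewrite lee_fin.
  apply: measure_sigma_subadditive => //.
  by apply: bigcup_measurable => m _.
rewrite nneseries_interchange; last by move=> i m; rewrite mule_ge0// lee_fin.
apply: lee_nneseries => m _.
  by move=> _; apply: nneseries_ge0 => i _ _; rewrite mule_ge0// lee_fin.
rewrite (nneseriesD1 (n := (s m).2))//; last by move=> i _; rewrite mule_ge0// lee_fin.
rewrite eseries0 ?adde0; first by rewrite /E eqxx.
by move=> i _ /=; rewrite /E eq_sym => /negbTE ->; rewrite measure0 mule0.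
Qed.

Let below i j := (lev j <= lev i)%N /\ D i `<=` D j.

(* Of two families of nested cells, a cell contained in a cell of the other
   family goes to the intersection and the others to the union. Comparing levels
   weakly in one case and strictly in the other decides ties consistently. *)
Let hit2 e i : set X := [set x | exists j, e j x /\ below i j].
Let hit1 e i : set X := [set x | exists j, [/\ e j x, below i j & (lev j < lev i)%N]].

Definition fam_union e1 e2 i := (e1 i `\` hit2 e2 i) `|` (e2 i `\` hit1 e1 i).
Definition fam_inter e1 e2 i := (e1 i `&` hit2 e2 i) `|` (e2 i `&` hit1 e1 i).

Let measurable_hit2 e i : (forall j, measurable (e j)) -> measurable (hit2 e i).
Proof.
move=> me; rewrite (_ : hit2 e i = \bigcup_(j in [set j | below i j]) e j).
  by apply: bigcup_measurable.
by apply/seteqP; split=> x; [move=> [j [? ?]]; exists j|move=> [j ? ?]; exists j].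
Qed.

Let measurable_hit1 e i : (forall j, measurable (e j)) -> measurable (hit1 e i).
Proof.
move=> me.
rewrite (_ : hit1 e i = \bigcup_(j in [set j | below i j /\ (lev j < lev i)%N]) e j).
  by apply: bigcup_measurable.
by apply/seteqP; split=> x; [move=> [j [? ? ?]]; exists j|move=> [j [? ?] ?]; exists j].
Qed.

Lemma measurable_fam_union e1 e2 i : (forall j, measurable (e1 j)) ->
  (forall j, measurable (e2 j)) -> measurable (fam_union e1 e2 i).
Proof.
move=> m1 m2; apply: measurableU; apply: measurableD => //.
  exact: measurable_hit2.
exact: measurable_hit1.
Qed.

Lemma measurable_fam_inter e1 e2 i : (forall j, measurable (e1 j)) ->
  (forall j, measurable (e2 j)) -> measurable (fam_inter e1 e2 i).
Proof.
move=> m1 m2; apply: measurableU; apply: measurableI => //.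
  exact: measurable_hit2.
exact: measurable_hit1.
Qed.

(** Strong subadditivity. Each occurrence of a cell in [e1] or [e2] goes to exactly one of the two
    new families: [e1 i] is cut by [hit2 e2 i], and [e2 i] by [hit1 e1 i]. *)
Lemma fam_cost_modular e1 e2 : (forall j, measurable (e1 j)) ->
  (forall j, measurable (e2 j)) ->
  fam_cost (fam_union e1 e2) + fam_cost (fam_inter e1 e2) <=
  fam_cost e1 + fam_cost e2.
Proof.
move=> m1 m2.
rewrite /fam_cost -nneseriesD; try by move=> i _ _; rewrite mule_ge0// lee_fin.
rewrite -nneseriesD; try by move=> i _ _; rewrite mule_ge0// lee_fin.
apply: lee_nneseries => i _.
  by move=> _; rewrite adde_ge0// mule_ge0// lee_fin.
rewrite -!muleDr ?ge0_adde_def ?inE//; try by rewrite lee_fin.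
apply: lee_wpmul2l; first by rewrite lee_fin.
have m2' := measurable_hit2 i m2; have m1' := measurable_hit1 i m1.
apply: (@le_trans _ _ ((mu (e1 i `\` hit2 e2 i) + mu (e2 i `\` hit1 e1 i)) +
                       (mu (e1 i `&` hit2 e2 i) + mu (e2 i `&` hit1 e1 i)))).
  by apply: leeD; apply: measureU2; first [exact: measurableD|exact: measurableI].
rewrite addeACA le_eqVlt; apply/orP; left; apply/eqP; congr (_ + _).
  by rewrite -measureDI.
by rewrite -measureDI.
Qed.

(** Two cells through the same point are nested, and the smaller one goes to [fam_inter]. *)
Lemma fam_inter_cover e1 e2 :
  fam_cover e1 `&` fam_cover e2 `<=` fam_cover (fam_inter e1 e2).
Proof.
move=> z [[i [ei Di]] [j [ej Dj]]].
have [lij|lji] := leqP (lev j) (lev i).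
  exists i; split => //; left; split => //; exists j; split => //.
  by split => //; apply: D_nested lij; [exact: Dj|exact: Di].
exists j; split => //; right; split => //; exists i; split => //.
by split; [exact: ltnW|apply: D_nested (ltnW lji); [exact: Di|exact: Dj]].
Qed.

(** Induction on the level reduces to a cell of minimal level through the point. If it is discarded
    from [e1], the cell of [e2] containing it has no strictly coarser competitor in [e1] and is
    kept. The bound on the level of the result is what makes minimal cells persist under repeated
    unions. *)
Lemma fam_union_cover e1 e2 x y i : e1 i x \/ e2 i x -> D i y ->
  exists j, [/\ (lev j <= lev i)%N, fam_union e1 e2 j x & D j y].
Proof.
have [n] := ubnP (lev i); elim: n i => // n IH i; rewrite ltnS => lin ei Di.
have [[j [ej Dj ji]]|nj] := pselect (exists j, [/\ e1 j x \/ e2 j x, D j y &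
    (lev j < lev i)%N]).
  have [k [kj ? ?]] := IH j (leq_trans ji lin) ej Dj.
  by exists k; split => //; rewrite (leq_trans kj)// ltnW.
have [e2i|ne2i] := pselect (e2 i x).
  exists i; split => //; right; split => // -[j [ej [_ Dij] ji]].
  by apply: nj; exists j; split => //; [left|exact: Dij].
have e1i : e1 i x by case: ei.
have [[j [ej [lji Dij]]]|h] := pselect (hit2 e2 i x); last by exists i; split => //; left.
exists j; split => //; last exact: Dij.
right; split => // -[k [ek [_ Djk] kj]]; apply: nj; exists k; split; [by left| |].
  by apply: Djk; exact: Dij.
exact: leq_trans lji.
Qed.

(** Fatou's lemma for families: continuity of [mu] along increasing sets, applied to finitely many
    cells at a time. *)
Lemma fam_liminf_cost (v : nat -> nat -> set X) (M : \bar R) :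
  (forall m i, measurable (v m i)) -> (forall m, fam_cost (v m) <= M) ->
  fam_cost (fun i => \bigcup_m \bigcap_(l in [set l | (m <= l)%N]) v l i) <= M.
Proof.
move=> mv vM; pose G m i := \bigcap_(l in [set l | (m <= l)%N]) v l i.
have mG m i : measurable (G m i) by apply: bigcap_measurableType.
apply: lime_le; first by apply: is_cvg_nneseries => i _ _; rewrite mule_ge0// lee_fin.
near=> n.
have cvgG : (\sum_(0 <= i < n) (w i)%:E * mu (G m i)) @[m --> \oo] -->
    \sum_(0 <= i < n) (w i)%:E * mu (\bigcup_m G m i).
  apply: cvg_nnesum => [i _|i _].
    by near=> m; rewrite mule_ge0// lee_fin.
  apply: cvgeZl => //; apply: nondecreasing_cvg_mu => //.
    by apply: bigcup_measurable.
  move=> m p mp; apply/subsetPset => x Gx l /= pl; apply: Gx.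
  exact: leq_trans pl.
rewrite -(cvg_lim _ cvgG)//; apply: lime_le; first by apply/cvg_ex; eexists; exact: cvgG.
near=> m; apply: le_trans (vM m).
apply: (@le_trans _ _ (\sum_(0 <= i < n) (w i)%:E * mu (v m i))).
  apply: lee_sum => i _; apply: lee_wpmul2l; first by rewrite lee_fin.
  by apply: le_measure; rewrite ?inE// => x; apply=> /=.
by apply: nneseries_lim_ge => i _; rewrite mule_ge0// lee_fin.
Unshelve. all: by end_near. Qed.

(** Nearly optimal families for the [A m] are united successively. Since [A m] is covered by both
    [e m.+1] and [v m], strong subadditivity pays back [net_cap (A m)] at each union, and only the
    errors [t m] accumulate. *)
Lemma net_cap_nondecreasing (A : nat -> set (X * Y)) (a : R) :
  (forall m, A m `<=` A m.+1) -> (forall m, net_cap (A m) <= a%:E) ->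
  net_cap (\bigcup_m A m) <= a%:E.
Proof.
move=> AS Aa; apply/lee_addgt0Pr => eps eps0.
have capfin m : net_cap (A m) \is a fin_num.
  rewrite ge0_fin_numE ?(le_lt_trans (Aa m)) ?ltey//.
  by apply: gauge_ge0; exact: net_cost_ge0.
pose t m : R := (eps / (2 ^ m.+1)%:R)%R.
have t0 m : (0 < t m)%R by rewrite divr_gt0// ltr0n expn_gt0.
have /choice[e eP] m : exists e, [/\ forall i, measurable (e i),
    A m `<=` fam_cover e & fam_cost e <= net_cap (A m) + (t m)%:E].
  by apply: net_cap_family; rewrite lteDl// lte_fin.
pose v := fix v m := if m is m'.+1 then fam_union (e m'.+1) (v m') else e 0%N.
have mv m i : measurable (v m i).
  elim: m i => [|m IH] i /=; first by have [] := eP 0%N.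
  by apply: measurable_fam_union => // j; have [] := eP m.+1.
have Av m : A m `<=` fam_cover (v m).
  case: m => [|m] z; first by have [_ + _] := eP 0%N; exact.
  have [_ + _] := eP m.+1 => /[apply] -[i [ei Di]].
  have [|j [_ vj Dj]] := @fam_union_cover (e m.+1) (v m) z.1 z.2 i _ Di; first by left.
  by exists j.
have vcost m : fam_cost (v m) <= net_cap (A m) + (\sum_(0 <= l < m.+1) t l)%:E.
  elim: m => [|m IH]; first by rewrite big_nat1; have [] := eP 0%N.
  have [me1 Ae1 ce1] := eP m.+1.
  have := fam_cost_modular me1 (mv m).
  have Acap : net_cap (A m) <= fam_cost (fam_inter (e m.+1) (v m)).
    apply: net_cap_le_fam => [i|z Az]; first exact: measurable_fam_inter.
    by apply: fam_inter_cover; split; [exact/Ae1/AS|exact: Av].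
  move=> /(le_trans (leeD2l _ Acap)) /le_trans /(_ (leeD ce1 IH)).
  rewrite [X in _ <= X](_ : _ = net_cap (A m.+1) + (\sum_(0 <= l < m.+2) t l)%:E + net_cap (A m)).
    by rewrite leeD2rE.
  rewrite [in RHS]big_nat_recr//= [in RHS]EFinD.
  by rewrite addeACA [RHS]addeAC (addeC (t m.+1)%:E).
pose vlim i := \bigcup_m \bigcap_(l in [set l | (m <= l)%N]) v l i.
apply: (@le_trans _ _ (fam_cost vlim)); last first.
  apply: fam_liminf_cost => // m; apply: (le_trans (vcost m)).
  apply: leeD => //; rewrite -sumEFin.
  apply: (le_trans _ (epsilon_trick0 xpredT (ltW eps0))).
  by apply: nneseries_lim_ge => i _; rewrite lee_fin ltW.
(* A cell containing [y] of minimal level among all the [v m] at [x] is never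
   removed afterwards, hence survives in the liminf family. *)
apply: net_cap_le_fam => [i|[x y] [m0 _ /Av[i0 [/= vi0 Di0]]]].
  by apply: bigcup_measurable => m _; apply: bigcap_measurableType.
have [n [[m [i [vi Di lin]]] nmin]] : exists n, (exists m i, [/\ v m i x, D i y & lev i = n])
    /\ forall m i, v m i x -> D i y -> (n <= lev i)%N.
  pose P n := `[< exists m i, [/\ v m i x, D i y & lev i = n] >].
  have exP : exists n, P n by exists (lev i0); apply/asboolP; exists m0, i0.
  case: (ex_minnP exP) => n /asboolP[m [i Pn]] nmin; exists n; split.
    by exists m, i.
  by move=> m' i' ? ?; apply: nmin; apply/asboolP; exists m', i'.
exists i; split => //=; exists m => // l /=.
elim: l => [|l IH]; first by rewrite leqn0 => /eqP <-.
rewrite leq_eqVlt => /predU1P[<-//|]; rewrite ltnS => /IH vli.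
right; split => // -[j [ej [_ Dij] ji]].
have [|k [kj vk Dk]] := @fam_union_cover (e l.+1) (v l) x y j _ (Dij _ Di); first by left.
have := nmin l.+1 k vk Dk; rewrite leqNgt -lin.
by rewrite (leq_ltn_trans kj).
Qed.

End NetCapacity.

(** * Souslin sets and capacitability *)

Section SeqConstruction.

Lemma mkseqS_rcons T (h : nat -> T) n : mkseq h n.+1 = rcons (mkseq h n) (h n).
Proof. by rewrite /mkseq -addn1 iotaD map_cat cats1. Qed.

Lemma seq_dependent_choice (Q : seq nat -> Prop) : Q [::] ->
  (forall s, Q s -> exists b, Q (rcons s b)) ->
  exists h : nat -> nat, forall n, Q (mkseq h n).
Proof.
move=> Q0 QS; have /choice[b bP] s : exists b, Q s -> Q (rcons s b).
  by have [/QS[b]|] := pselect (Q s); [exists b|exists 0%N].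
pose s_ := fix s n := if n is n'.+1 then rcons (s n') (b (s n')) else [::].
exists (fun n => b (s_ n)) => n.
have -> : mkseq (fun n => b (s_ n)) n = s_ n.
  by elim: n => // n IH; rewrite mkseqS_rcons IH.
by elim: n => //= n; exact: bP.
Qed.

End SeqConstruction.

Section Souslin.
Context {Z : topologicalType}.
Implicit Types (A : set Z) (sigma tau h : nat -> nat) (P : nat -> (nat -> nat) -> set Z).

(* [P n sigma] depends only on the first [n] values of [sigma]. *)
Definition scheme P := (forall n sigma, closed (P n sigma)) /\
  (forall n sigma tau, (forall i, (i < n)%N -> sigma i = tau i) ->
    P n sigma = P n tau).

Definition souslin A := exists2 P, scheme P &
  A = [set z | exists sigma, forall n, P n sigma z].

Lemma closed_souslin A : closed A -> souslin A.
Proof.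
move=> cA; exists (fun _ _ => A); first by split.
by apply/seteqP; split=> z; [exists id|move=> [_ /(_ 0%N)]].
Qed.

Lemma souslin_bigcup (F : nat -> set Z) : (forall k, souslin (F k)) ->
  souslin (\bigcup_k F k).
Proof.
move=> /(_ _)/cid2-/all_sig2[P Psch PF].
exists (fun n sigma => if n is m.+1 then P (sigma 0%N) m (sigma \o S) else setT).
  split=> [[|n] sigma|[|n] sigma tau st //]; [exact: closedT|exact: (Psch _).1|].
  by rewrite (st 0%N)//; apply: (Psch _).2 => i lin /=; exact: st.
apply/seteqP; split=> [z [k _]|z [sigma Pz]].
  rewrite PF => -[sigma Pz].
  by exists (fun i => if i is j.+1 then sigma j else k) => -[|n] //; exact: Pz.
by exists (sigma 0%N) => //; rewrite PF; exists (sigma \o S) => n; exact: (Pz n.+1).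
Qed.

Let pair i l := Cantor.to_nat (i, l).

Let pair_lt i l m : (l < m)%N -> (pair i l < pair i m)%N.
Proof.
move=> lm; have := Cantor.to_nat_spec i l; have := Cantor.to_nat_spec i m.
rewrite -/(pair i l) -/(pair i m); nia.
Qed.

(** One sequence stores a witness for every [k], in its entries [pair k l]. Condition number
    [pair k m] tests the [m]-th condition for [k]; as [pair] increases in its second argument, only
    earlier entries are read. *)
Lemma souslin_bigcap (F : nat -> set Z) : (forall k, souslin (F k)) ->
  souslin (\bigcap_k F k).
Proof.
move=> /(_ _)/cid2-/all_sig2[P Psch PF].
exists (fun n sigma => \bigcap_(p in [set p : nat * nat | pair p.1 p.2 = n])
    P p.1 p.2 (fun l => sigma (pair p.1 l))).
  split=> [n sigma|n sigma tau st].
    by apply: closed_bigI => p _; exact: (Psch _).1.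
  apply: eq_bigcapr => p /= pn; apply: (Psch _).2 => l lp.
  by apply: st; rewrite -pn; exact: pair_lt.
apply/seteqP; split=> [z Fz|z [sigma Pz] k _].
  have /choice[s sP] k : exists s, forall n, P k n s z.
    by have := Fz k I; rewrite PF.
  exists (fun n => s (Cantor.of_nat n).1 (Cantor.of_nat n).2) => n [k m] /= _.
  rewrite (_ : (fun l => _) = s k)//; apply/funext => l.
  by rewrite Cantor.cancel_of_to.
by rewrite PF; exists (fun l => sigma (pair k l)) => n; exact: (Pz (pair k n) (k, n)).
Qed.

(** The entries of [s] are upper bounds rather than prescribed values, so that these sets increase
    with the last entry of [s]. *)
Definition trunc_souslin P (s : seq nat) : set Z := [set z | exists sigma,
  (forall i, (i < size s)%N -> (sigma i <= nth 0 s i)%N) /\ forall n, P n sigma z].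

Definition souslin_layer P h N : set Z := [set z | exists sigma,
  (forall i, (sigma i <= h i)%N) /\ forall n, (n <= N)%N -> P n sigma z].

(** Conditions up to [N] read only the first [N] entries, which are bounded by [h]: the layer is a
    finite union of closed sets. *)
Lemma closed_souslin_layer P h N : scheme P -> closed (souslin_layer P h N).
Proof.
move=> [Pcl Ploc].
pose M := (\max_(i < N) h i).+1.
pose ext (f : {ffun 'I_N -> 'I_M}) i := if insub i is Some j then f j : nat else 0%N.
pose valid (f : {ffun 'I_N -> 'I_M}) := forall i, (ext f i <= h i)%N.
rewrite (_ : souslin_layer P h N =
    \bigcup_(f in [set f | valid f]) \bigcap_(n in [set n | (n <= N)%N]) P n (ext f)).
  apply: closed_bigcup => [|f _]; first exact: finite_finset.
  by apply: closed_bigI.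
apply/seteqP; split=> [z [sigma [sh Pz]]|z [f vf Pz]]; last by exists (ext f).
have sM (i : 'I_N) : (sigma i < M)%N.
  by rewrite ltnS (leq_trans (sh i))// (leq_bigmax i).
pose f : {ffun 'I_N -> 'I_M} := [ffun i => Ordinal (sM i)].
have fs i : (i < N)%N -> ext f i = sigma i.
  by move=> iN; rewrite /ext insubT ffunE.
exists f => [i|n /= nN].
  have [iN|Ni] := ltnP i N; first by rewrite fs.
  by rewrite /ext insubF// ltnNge Ni.
rewrite (Ploc _ _ sigma); first exact: Pz.
by move=> i lin; apply: fs; exact: leq_trans nN.
Qed.

(** König's lemma for the tree of finite sequences bounded by [h], which is finitely branching. *)
Lemma konig_souslin P h z : scheme P -> (forall N, souslin_layer P h N z) ->
  exists sigma, forall n, P n sigma z.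
Proof.
move=> [_ Ploc] Kz.
pose good s := forall N, exists sigma, [/\ forall i, (sigma i <= h i)%N,
  forall i, (i < size s)%N -> sigma i = nth 0%N s i &
  forall n, (n <= N)%N -> P n sigma z].
have [||sigma sP] := @seq_dependent_choice good.
- by move=> N; have [s [? ?]] := Kz N; exists s.
- move=> s gs; apply: contrapT => /forallNP nb.
  have /choice[N NP] b : exists N, ~ exists sigma, [/\ forall i, (sigma i <= h i)%N,
    forall i, (i < size (rcons s b))%N -> sigma i = nth 0%N (rcons s b) i &
    forall n, (n <= N)%N -> P n sigma z].
    by apply: contrapT => /forallNP h'; apply: (nb b) => N; apply: contrapT; exact: h'.
  (* If every extension of [s] failed, each at some stage [N b], then the maximum of these finitely
     many stages would contradict [good s]. *)
  have [sigma [sh ss sz]] := gs (\max_(b < (h (size s)).+1) N b).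
  apply: (NP (sigma (size s))); exists sigma; split=> // [i|n nN].
    rewrite size_rcons ltnS leq_eqVlt => /predU1P[->|lis].
      by rewrite nth_rcons ltnn eqxx.
    by rewrite nth_rcons lis ss.
  apply: sz; apply: (leq_trans nN).
  have lt : (sigma (size s) < (h (size s)).+1)%N by rewrite ltnS.
  exact: (@leq_bigmax _ (fun b : 'I_(h (size s)).+1 => N b) (Ordinal lt)).
exists sigma => n; have [tau [_ ts /(_ n (leqnn n))]] := sP n n.
rewrite (Ploc n tau sigma)// => i lin.
by rewrite ts ?size_mkseq// nth_mkseq.
Qed.

End Souslin.

Section BorelSouslin.
Context {R : realType} {V : normedModType R}.

Lemma open_souslin (U : set V) : open U -> souslin U.
Proof.
move=> oU.
rewrite (_ : U = \bigcup_n \bigcap_(y in ~` U) [set x | n.+1%:R^-1 <= `|x - y|]).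
  apply: souslin_bigcup => n; apply: closed_souslin; apply: closed_bigI => y _.
  have -> : [set x | n.+1%:R^-1 <= `|x - y|] =
     (fun x : V => `|x - y|) @^-1` [set r | n.+1%:R^-1 <= r] by [].
  apply: closed_comp => [x _|]; last exact: closed_ge.
  by apply: cvg_norm; apply: cvgB; [exact: cvg_id|exact: cvg_cst].
apply/seteqP; split=> [x Ux|x [n _ h]].
  have [r [r0 rU]] := open_ball_sub oU Ux.
  have [m _ hm] := near_infty_natSinv_lt (PosNum r0).
  exists m => // y nUy /=; rewrite leNgt; apply/negP => xy; apply: nUy; apply: rU.
  by rewrite -ball_normE /= (lt_trans xy)// (hm m)//=.
apply: contrapT => nUx; have := h x nUx => /=.
by rewrite subrr normr0 leNgt invr_gt0 ltr0n.
Qed.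

(** The sets that are Souslin together with their complements form a sigma-algebra containing the
    open sets. *)
Lemma borel_souslin (A : set V) : borel A -> souslin A.
Proof.
suff : <<s [set U : set V | open U] >> `<=`
    [set A | souslin A /\ souslin (~` A)] by move=> h /h[].
apply: smallest_sub => [|U oU]; last first.
  by split; [exact: open_souslin|apply: closed_souslin; exact: open_closedC].
split=> [|B [sB sCB]|F FS].
- by rewrite /= setC0; split; apply: closed_souslin; [exact: closed0|exact: closedT].
- by rewrite /= setTD setCK.
- split; first by apply: souslin_bigcup => n; exact: (FS n).1.
  by rewrite /= setC_bigcup; apply: souslin_bigcap => n; exact: (FS n).2.
Qed.

End BorelSouslin.

Section Choquet.
Context {R : realType} {Z : normedModType R}.
Variable cap : set Z -> \bar R.
Local Open Scope ereal_scope.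
Hypothesis le_cap : forall A B : set Z, A `<=` B -> cap A <= cap B.
Hypothesis cap_nondecreasing : forall (A : nat -> set Z) (a : R),
  (forall m, A m `<=` A m.+1) -> (forall m, cap (A m) <= a%:E) ->
  cap (\bigcup_m A m) <= a%:E.

(** Continuity along increasing sequences yields bounds [h] for which all truncations keep capacity
    above [a]. Within [K0], the closed layers bounded by [h] decrease to a compact set, contained in
    [A] by König's lemma, and any open set around it already contains one of them. Stating the bound
    for open neighbourhoods of [K] avoids a continuity property of [cap] on compact sets. *)
Lemma choquet_capacitability (A K0 : set Z) (a : R) :
  souslin A -> A `<=` K0 -> compact K0 -> closed K0 -> a%:E < cap A ->
  exists K, [/\ compact K, K `<=` A &
    forall W, open W -> K `<=` W -> a%:E < cap W].
Proof.
move=> [P Psch AP] AK0 cK0 clK0 aA.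
have [||h hP] := @seq_dependent_choice (fun s => a%:E < cap (trunc_souslin P s)).
- by apply: (lt_le_trans aA); apply: le_cap; rewrite AP => z [sigma Pz]; exists sigma.
- move=> s; apply: contraPP => /forallNP nb; apply/negP; rewrite -leNgt.
  have -> : trunc_souslin P s = \bigcup_b trunc_souslin P (rcons s b).
    apply/seteqP; split=> [z [sigma [ss Pz]]|z [b _ [sigma [ss Pz]]]].
      exists (sigma (size s)) => //; exists sigma; split=> // i.
      rewrite size_rcons ltnS leq_eqVlt => /predU1P[->|lis].
        by rewrite nth_rcons ltnn eqxx.
      by rewrite nth_rcons lis ss.
    exists sigma; split=> // i lis; have := ss i.
    by rewrite size_rcons nth_rcons lis ltnS ltnW//; exact.
  apply: cap_nondecreasing => [b z [sigma [ss Pz]]|b]; last first.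
    by rewrite leNgt; apply/negP; exact: nb.
  exists sigma; split=> // i lis; have := ss i; rewrite !size_rcons in lis *.
  move=> /(_ lis)/leq_trans; apply; rewrite !nth_rcons.
  by case: ifP => // _; case: ifP.
pose L N := souslin_layer P h N.
have LS m n : (m <= n)%N -> L n `<=` L m.
  by move=> mn z [s [sh Pz]]; exists s; split=> // i im; apply: Pz; exact: leq_trans mn.
have cL N : closed (L N) by exact: closed_souslin_layer.
have truncL N : trunc_souslin P (mkseq h N) `<=` L N.
  move=> z [s [sh Pz]]; exists (fun i => if (i < N)%N then s i else 0%N); split.
    by move=> i; case: ifPn => // iN; have := sh i; rewrite size_mkseq nth_mkseq//; exact.
  move=> n nN; rewrite (Psch.2 n _ s) => [//|i lin].
  by rewrite (leq_trans lin nN).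
exists (K0 `&` \bigcap_N L N); split.
- apply: (subclosed_compact _ cK0) => //; apply: closedI => //.
  by apply: closed_bigI => N _.
- move=> z [_ Lz]; rewrite AP; apply: konig_souslin Psch _ => N; exact: Lz.
move=> W oW KW.
have [N KN] : exists N, K0 `&` L N `<=` W.
  have : compact (K0 `\` W).
    apply: (subclosed_compact _ cK0) => //.
    by apply: closedI => //; exact: open_closedC.
  rewrite compact_cover => /(_ nat setT (fun N => ~` L N))[].
  - by move=> N _; exact: closed_openC.
  - move=> z [K0z nWz]; apply: contrapT => h'; apply: nWz; apply: KW; split=> // N _.
    by apply: contrapT => nL; apply: h'; exists N.
  move=> F _ Fcov; exists (\max_(i <- finmap.enum_fset F) i)%N => z [K0z Lz].
  apply: contrapT => nWz; have [i iF] := Fcov z (conj K0z nWz); apply.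
  by apply: LS Lz; rewrite /= in iF; exact: (@leq_bigmax_seq _ _ xpredT id).
apply: (lt_le_trans (hP N)); apply: le_cap => z Az; apply: KN; split.
  by apply: AK0; rewrite AP; case: Az => s [_ ?]; exists s.
exact: truncL.
Qed.

End Choquet.

(** * Dyadic cubes *)

Section Dyadic.
Context {R : realType}.

Definition dyad (j : nat) : R := (2^-1) ^+ j.

Lemma dyad_gt0 j : 0 < dyad j.
Proof. by rewrite exprn_gt0// invr_gt0. Qed.

Lemma dyad_le1 j : dyad j <= 1.
Proof. by rewrite exprn_ile1// ?invr_ge0// invf_le1// ler1n. Qed.

Lemma dyadS j : dyad j = 2 * dyad j.+1.
Proof. by rewrite /dyad exprS mulrA divff// mul1r. Qed.

Lemma dyad_scale (r : R) : 0 < r -> r <= 1 -> exists j, dyad j.+1 < r <= dyad j.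
Proof.
move=> r0 r1; have exj : exists j, dyad j.+1 < r.
  have [m _ hm] := near_infty_natSinv_expn_lt (PosNum r0).
  exists m; have /= := hm m (leqnn m); rewrite div1r -exprVn; apply: le_lt_trans.
  by rewrite /dyad exprS ler_piMl ?exprn_ge0// invf_le1// ler1n.
case: (ex_minnP exj) => -[|j] jr jmin; first by exists 0%N; rewrite jr.
exists j.+1; rewrite jr/= leNgt; apply/negP => /jmin.
by rewrite ltnn.
Qed.

End Dyadic.

(* [cell_count]: a ball of radius [L * 2^-j] meets boundedly many cells of
   level [j], uniformly in [j]. *)
Record net {R : realType} {Y : normedModType R} := Net {
  cell : nat -> set Y;
  level : nat -> nat;
  cell_nested : forall i j y, cell i y -> cell j y ->
    (level i <= level j)%N -> cell j `<=` cell i;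
  cell_exists : forall j y, exists2 i, level i = j & cell i y;
  cell_diam : forall i x y, cell i x -> cell i y ->
    `|x - y| <= dyad (level i) :> R;
  cell_count : forall L : R, exists N : nat, forall j y0, exists s : seq nat,
    [/\ (size s <= N)%N, forall i, i \in s -> level i = j &
      forall i y, level i = j -> cell i y -> `|y - y0| <= L * dyad j -> i \in s] }.
Arguments net {R} Y.

Section DyadicNet.
Context {R : realType} (n : nat).

Let code (j : nat) (y : 'rV[R]_n) : {ffun 'I_n -> int} :=
  [ffun c => Num.floor (y 0 c * 2 ^+ j)].

(** Natural numbers encode pairs of a level and an integer vector; a number that encodes nothing
    gives an empty cell. *)
Let cube (i : nat) : set 'rV[R]_n := [set y |
  if (pickle_inv i : option (nat * {ffun 'I_n -> int})) is Some p then code p.1 y = p.2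
  else False].

Let cube_level (i : nat) : nat :=
  if (pickle_inv i : option (nat * {ffun 'I_n -> int})) is Some p then p.1 else 0%N.

Let cubeP i y : cube i y -> exists p : nat * {ffun 'I_n -> int},
  [/\ i = pickle p, cube_level i = p.1 & forall z, cube i z <-> code p.1 z = p.2].
Proof.
rewrite /cube /cube_level /=.
case E : (pickle_inv i : option (nat * {ffun 'I_n -> int})) => [p|//] _.
exists p; split => //.
have := @pickle_invK (nat * {ffun 'I_n -> int})%type i.
by rewrite E.
Qed.

Let floor_coarsen (u v : R) (k : nat) : Num.floor u = Num.floor v ->
  (Num.floor (u / 2 ^+ k) <= Num.floor (v / 2 ^+ k))%R.
Proof.
move=> uv; rewrite floor_ge_int ler_pdivlMr ?exprn_gt0//.
have -> : (Num.floor (u / 2 ^+ k))%:~R * 2 ^+ k =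
          (Num.floor (u / 2 ^+ k) * 2 ^+ k)%:~R :> R by rewrite intrM rmorphXn.
rewrite -floor_ge_int -uv floor_ge_int intrM rmorphXn /= -ler_pdivlMr ?exprn_gt0//.
exact: floor_le.
Qed.

Let code_coarsen i j x y : (i <= j)%N -> code j x = code j y -> code i x = code i y.
Proof.
move=> ij /ffunP jxy; apply/ffunP => c; have := jxy c; rewrite !ffunE => xy.
have E z : z * 2 ^+ i = z * 2 ^+ j / 2 ^+ (j - i) :> R.
  by rewrite -[in 2 ^+ j](subnKC ij) exprD mulrA mulfK// expf_neq0.
by rewrite !E; apply/eqP; rewrite eq_le !floor_coarsen.
Qed.

Let cube_nested i j y : cube i y -> cube j y ->
  (cube_level i <= cube_level j)%N -> cube j `<=` cube i.
Proof.
move=> Ci Cj; have [p [_ -> ip]] := cubeP Ci; have [q [_ -> jq]] := cubeP Cj.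
move=> pq z /jq qz; apply/ip; move/ip: Ci => <-; apply: code_coarsen pq _.
by rewrite qz; move/jq: Cj.
Qed.

Let cube_exists j y : exists2 i, cube_level i = j & cube i y.
Proof.
by exists (pickle (j, code j y)); rewrite /cube_level /cube /= pickleK_inv.
Qed.

Let floor_dist (u v : R) (m : int) : `|u - v| <= m%:~R ->
  - (m + 1) <= Num.floor u - Num.floor v <= m + 1.
Proof.
have /andP[u1 u2] := floor_itv u; have /andP[v1 v2] := floor_itv v.
rewrite ler_norml => /andP[h1 h2].
rewrite !intrD in u2 v2.
have a : (Num.floor u)%:~R < (Num.floor v + m + 1)%:~R :> R by rewrite !intrD; lra.
have b : (Num.floor v)%:~R < (Num.floor u + m + 1)%:~R :> R by rewrite !intrD; lra.
rewrite !ltr_int in a b; lia.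
Qed.

Let cube_diam i x y : cube i x -> cube i y -> `|x - y| <= dyad (cube_level i) :> R.
Proof.
move=> Cx Cy; have [p [_ -> ip]] := cubeP Cx.
have /ffunP xy : code p.1 x = code p.1 y by move/ip: Cx => ->; move/ip: Cy.
apply: mx_norm_leP => [|c]; first exact: ltW (dyad_gt0 _).
have := xy c; rewrite !ffunE !mxE => fxy.
have /andP[u1 u2] := floor_itv (x 0 c * 2 ^+ p.1).
have /andP[v1 v2] := floor_itv (y 0 c * 2 ^+ p.1).
have d0 : (0 : R) < 2 ^+ p.1 by rewrite exprn_gt0.
rewrite /dyad exprVn -[leRHS]div1r ler_pdivlMr// -[X in _ * X](gtr0_norm d0) -normrM.
rewrite mulrBl ler_norml; rewrite fxy !intrD in u1 u2 v1 v2 *.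
by apply/andP; split; lra.
Qed.

Let cube_count (L : R) : exists N : nat, forall j y0, exists s : seq nat,
  [/\ (size s <= N)%N, forall i, i \in s -> cube_level i = j &
    forall i y, cube_level i = j -> cube i y -> `|y - y0| <= L * dyad j -> i \in s].
Proof.
pose M := `|Num.ceil `|L| |%N.+1.
exists #|{ffun 'I_n -> 'I_(M + M).+1}| => j y0.
(* The candidates are the cubes whose code differs from that of [y0] by at most [M] in each
   coordinate; rounding to integers adds the 1 in [M]. *)
pose dec (g : {ffun 'I_n -> 'I_(M + M).+1}) : {ffun 'I_n -> int} :=
  [ffun c => code j y0 c + ((g c)%:Z - M%:Z)].
exists [seq pickle (j, dec g) | g <- enum {ffun 'I_n -> 'I_(M + M).+1}]; split.
- by rewrite size_map -cardE.
- by move=> i /mapP[g _ ->]; rewrite /cube_level pickleK_inv.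
move=> i y ij Cy yy0; have [p [ip0 _ ip]] := cubeP Cy.
rewrite ip0 in ij ip Cy *.
have lev : cube_level (pickle p) = p.1 by rewrite /cube_level pickleK_inv.
rewrite lev in ij; rewrite -ij in yy0; have /ip yE := Cy.
have ME : M%:Z = Num.ceil `|L| + 1.
  by rewrite /M -addn1 PoszD gez0_abs// ceil_ge0 (lt_le_trans (ltrN10 _)).
have bound c : - (M%:Z) <= code p.1 y c - code p.1 y0 c <= M%:Z.
  have : `|y 0 c * 2 ^+ p.1 - y0 0 c * 2 ^+ p.1| <= (Num.ceil `|L|)%:~R.
    rewrite -mulrBl normrM [X in _ * X]ger0_norm ?exprn_ge0// -ler_pdivlMr ?exprn_gt0//.
    rewrite -exprVn; apply: (@le_trans _ _ `|y - y0|).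
      by have := mx_norm_coord (y - y0) c; rewrite !mxE.
    apply: (le_trans yy0); apply: ler_wpM2r; first exact: ltW (dyad_gt0 _).
    by rewrite (le_trans (ler_norm _))// ceil_ge.
  by move=> /floor_dist; rewrite !ffunE ME.
pose g : {ffun 'I_n -> 'I_(M + M).+1} :=
  [ffun c => inord (absz (code p.1 y c - code p.1 y0 c + M%:Z))].
have gE c : (g c)%:Z = code p.1 y c - code p.1 y0 c + M%:Z.
  by rewrite [g c]ffunE inordK; have := bound c; lia.
apply/mapP; exists g; first by rewrite mem_enum.
rewrite (surjective_pairing p) -yE -ij /=; congr (pickle (_, _)).
by apply/ffunP => c; rewrite /dec [RHS]ffunE -ij gE addrK subrKC.
Qed.

Definition dyadic_net : net 'rV[R]_n :=
  Net cube_nested cube_exists cube_diam cube_count.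

End DyadicNet.

(** * Measurable covers of sectionwise null Borel sets *)

Section SectionwiseNull.
Context {R : realType} {V Y : normedModType R}.
Variables (mu : {outer_measure set V -> \bar R}) (N : net Y) (q : R).
Hypothesis mu_open : forall U : set V, open U -> mu.-caratheodory U.
Hypothesis mu_fin : (mu setT < +oo)%E.
Hypothesis q_gt0 : 0 < q.
Local Open Scope ereal_scope.

Definition net_weight (i : nat) : R := (dyad (level N i) `^ q)%R.

Lemma net_weight_ge0 i : (0 <= net_weight i)%R.
Proof. exact: powR_ge0. Qed.

Definition sect_cap (A : set (V * Y)) : \bar R :=
  @net_cap _ (caratheodory_type mu) R mu Y (cell N) net_weight A.

Lemma sect_cap_ge0 A : 0 <= sect_cap A.
Proof. by apply: gauge_ge0; apply: net_cost_ge0; exact: net_weight_ge0. Qed.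

Lemma sect_cap_sub (A B : set (V * Y)) : A `<=` B -> sect_cap A <= sect_cap B.
Proof. exact: le_gauge. Qed.

Lemma sect_cap_bigcup (A : set (V * Y)) (F : nat -> set (V * Y)) :
  A `<=` \bigcup_i F i -> sect_cap A <= \sum_(0 <= i <oo) sect_cap (F i).
Proof. by apply: gauge_sigma_subadditive; apply: net_cost_ge0; exact: net_weight_ge0. Qed.

Lemma sect_cap_cells (E : set V) (B : set Y) (s : seq nat) (b : R) :
  mu.-caratheodory E -> (forall i, i \in s -> (net_weight i <= b)%R) ->
  (forall y, B y -> exists2 i, i \in s & cell N i y) ->
  sect_cap (E `*` B) <= (size s)%:R%:E * b%:E * mu E.
Proof.
move=> mE sb Bs.
pose p m : set V * nat := if (m < size s)%N then (E, nth 0%N s m) else (set0, 0%N).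
have m0 : mu.-caratheodory set0 by exact: caratheodory_measurable_set0.
apply: (@le_trans _ _ (\sum_(0 <= m <oo) (net_weight (p m).2)%:E * mu (p m).1)).
  apply: (@gauge_le _ _ _ _ _ _ _ p); split.
    move=> [x y] [/= Ex /Bs[i si Dy]]; exists (index i s) => //.
    by rewrite /p index_mem si /= nth_index.
  by move=> m; rewrite /p; case: ifP.
rewrite (nneseries_split 0 (size s)); last first.
  by move=> k _; rewrite mule_ge0// lee_fin net_weight_ge0.
rewrite add0n [X in _ + X]eseries0 ?adde0; last first.
  by move=> m sm _; rewrite /p ltnNge sm /= outer_measure0 mule0.
apply: (@le_trans _ _ (\sum_(0 <= m < size s) b%:E * mu E)).
  rewrite !big_mkord; apply: lee_sum => m _; rewrite /p ltn_ord /=.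
  by apply: lee_wpmul2r => //; rewrite lee_fin sb// mem_nth.
by rewrite big_mkord sumr_const card_ord -muleA mule_natl.
Qed.

(** If [dyad j.+1 < r <= dyad j], a ball of radius [r] meets boundedly many cells of level [j], each
    of weight at most [(2 r) ^ q]. Adding 1 keeps the constant positive. *)
Lemma sect_cap_ball : exists C : R, (0 < C)%R /\
  forall E x r, mu.-caratheodory E -> (0 < r <= 1)%R ->
  sect_cap (E `*` ball x r) <= (C * r `^ q)%:E * mu E.
Proof.
have [M MP] := cell_count N 1.
exists (M%:R * 2 `^ q + 1)%R; split.
  by rewrite ltr_wpDl// mulr_ge0// powR_ge0.
move=> E x r mE /andP[r0 r1]; have [j /andP[jr rj]] := dyad_scale r0 r1.
have [s [sM sj sP]] := MP j x.
have := @sect_cap_cells E (ball x r) s (2 `^ q * r `^ q) mE _ _.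
move=> /(_ _ _)/le_trans; apply.
- move=> i /sj; rewrite /net_weight => ->; rewrite -powRM ?(ltW r0)//.
  apply: powR_le_base; [exact: ltW|exact: ltW (dyad_gt0 _)|].
  by rewrite (dyadS j) ler_pM2l// ltW.
- move=> y; rewrite -ball_normE /= => xy; have [i ij Dy] := cell_exists N j y.
  by exists i => //; apply: (sP _ y) => //; rewrite mul1r distrC (le_trans (ltW xy)).
apply: lee_wpmul2r; first exact: outer_measure_ge0.
rewrite -EFinM lee_fin mulrA; apply: ler_wpM2r; first exact: powR_ge0.
by rewrite (@le_trans _ _ (M%:R * 2 `^ q)%R)// ?lerDl// ler_wpM2r ?powR_ge0// ler_nat.
Qed.

(** Tube lemma: the points of [K] with second coordinate outside [O] form a compact set, whose
    projection is closed and misses [t]. *)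
Lemma compact_tube (K : set (V * Y)) (t : V) (O : set Y) : compact K -> open O ->
  xsection K t `<=` O ->
  exists r : R, (0 < r)%R /\ forall z, K z -> (`|t - z.1| <= r)%R -> O z.2.
Proof.
move=> cK oO KO.
have clK : closed K by apply: compact_closed cK; exact: norm_hausdorff.
have cK' : compact (K `&` snd @^-1` (~` O)).
  apply: (subclosed_compact _ cK) => //; apply: closedI => //.
  by apply: closed_comp => [x _|]; [exact: cvg_snd|exact: open_closedC].
have clF : closed (fst @` (K `&` snd @^-1` (~` O)) : set V).
  apply: compact_closed; first exact: norm_hausdorff.
  apply: continuous_compact => //; apply: continuous_subspaceT => x.
  exact: cvg_fst.
have nt : (~` (fst @` (K `&` snd @^-1` (~` O)))) t.
  by move=> [[t' y] [/= Kty nOy] tt]; apply: nOy; apply: KO; rewrite /xsection/= inE -tt.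
have [r [r0 rP]] := open_ball_sub (closed_openC clF) nt.
exists (r / 2)%R; split; first by rewrite divr_gt0.
move=> z Kz tz; apply: contrapT => nOz; apply: (rP z.1).
  by rewrite -ball_normE /= (le_lt_trans tz)// ltr_pdivrMr// ltr_pMr// ltr1n.
by exists z.
Qed.

Lemma compact_sect_cap (K : set (V * Y)) (a : R) : compact K -> (0 < a)%R ->
  (forall t, ball_null q (xsection K t)) ->
  exists W, [/\ open W, K `<=` W & sect_cap W <= a%:E].
Proof.
move=> cK a0 Knull.
have [C [C0 capC]] := sect_cap_ball.
pose M := (fine (mu setT) + 1)%R.
have M0 : (0 < M)%R by rewrite ltr_wpDl// fine_ge0// outer_measure_ge0.
have muM : mu setT <= M%:E.
  by rewrite -(@fineK _ (mu setT)) ?ge0_fin_numE ?outer_measure_ge0// lee_fin lerDl.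
(* Near each t, a cover of the section K_t still covers the sections of K, by
   compactness; finitely many such neighbourhoods cover the projection of K. *)
pose eta : R := Num.min 1%R (a / (C * M))%R.
have eta0 : (0 < eta)%R by rewrite lt_min ltr01 divr_gt0// mulr_gt0.
have /choice[Q QP] t : exists Q : set Y, [/\ open Q, xsection K t `<=` Q &
    forall E, mu.-caratheodory E -> sect_cap (E `*` Q) <= (C * eta)%:E * mu E].
  have /ball_nullP/(_ _ eta0)[x [r [r0 Kxr xre]]] := Knull t.
  have r1 m : (r m <= 1)%R.
    have : (r m `^ q <= 1 `^ q)%R.
      rewrite -lee_fin powR1; apply: le_trans (nneseries_term_le m _ xre) _.
        by move=> k; rewrite lee_fin powR_ge0.
      by rewrite lee_fin ge_min lexx.
    by rewrite leNgt => /negP h; rewrite leNgt; apply/negP => /(powR_lt_base q_gt0 ler01).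
  exists (\bigcup_m ball (x m) (r m)); split => //.
    by apply: bigcup_open => m _; exact: ball_open.
  move=> E mE; have Efin : mu E = (fine (mu E))%:E.
    rewrite fineK// ge0_fin_numE ?outer_measure_ge0//.
    by apply: le_lt_trans mu_fin; exact: le_outer_measure.
  have E0 : (0 <= fine (mu E))%R by rewrite fine_ge0// outer_measure_ge0.
  apply: (@le_trans _ _ (\sum_(0 <= m <oo) (fine (mu E) * C)%:E * (r m `^ q)%:E)).
    apply: (@le_trans _ _ (\sum_(0 <= m <oo) sect_cap (E `*` ball (x m) (r m)))).
      by apply: sect_cap_bigcup => -[u v] [/= Eu [m _ ?]]; exists m.
    apply: lee_nneseries => m _; first by move=> _; exact: sect_cap_ge0.
    have : (0 < r m <= 1)%R by rewrite r0 r1.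
    move=> /(capC E (x m) _ mE)/le_trans; apply; rewrite Efin -!EFinM lee_fin /=.
    by rewrite mulrC mulrA.
  rewrite nneseriesZl => [|m _]; last by rewrite lee_fin powR_ge0.
  rewrite Efin /= -EFinM (mulrC (C * _)%R) mulrA [in leRHS]EFinM.
  by apply: lee_wpmul2l; rewrite ?lee_fin// mulr_ge0// (ltW C0).
have /choice[r rP] t : exists r : R, (0 < r)%R /\
    forall z, K z -> (`|t - z.1| <= r)%R -> Q t z.2.
  by have [oQ KQ _] := QP t; exact: compact_tube.
have cF : compact (fst @` K : set V).
  by apply: continuous_compact => //; apply: continuous_subspaceT => x; exact: cvg_fst.
move: cF; rewrite (@compact_cover V) => /(_ V setT (fun t => ball t (r t)))[].
- by move=> t _; exact: ball_open.
- by move=> t _; exists t => //; apply: ballxx; exact: (rP t).1.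
move=> F _ FP.
pose l := finmap.enum_fset F; pose tt i := nth 0%R l i.
pose B i : set V := if (i < size l)%N then ball (tt i) (r (tt i)) else set0.
have oB i : open (B i) by rewrite /B; case: ifP => _; [exact: ball_open|exact: open0].
(* Closed, because the ball is taken closed: removing finitely many of these sets keeps the
   neighbourhood open, and leaves over each [B i] only points with second coordinate in
   [Q (tt i)]. *)
pose bad i : set (V * Y) := fst @^-1` [set u | (`|tt i - u| <= r (tt i))%R] `&`
  snd @^-1` (~` Q (tt i)).
have clbad i : closed (bad i).
  apply: closedI; apply: closed_comp => [x _|]; [exact: cvg_fst| |exact: cvg_snd|].
    exact: closed_dist_le.
  by apply: open_closedC; have [] := QP (tt i).
exists ((fst @^-1` \bigcup_i B i) `\` \bigcup_(i in `I_(size l)) bad i); split.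
- apply: openI.
    by apply: open_comp => [x _|]; [exact: cvg_fst|exact: bigcup_open].
  by apply: closed_openC; apply: closed_bigcup => [|i _]; [exact: finite_II|exact: clbad].
- move=> z Kz; split.
    have [t tF tz] := FP z.1 (ex_intro2 _ _ z Kz erefl).
    have tl : t \in l by [].
    by exists (index t l) => //; rewrite /B index_mem tl /tt nth_index.
  by move=> [i _ [/= tz]]; apply; exact: (rP (tt i)).2.
(* Disjoint pieces have measures adding up to at most [mu setT], whatever the number of balls. *)
pose E := seqDU B.
have mE i : mu.-caratheodory (E i).
  apply: (@seqDU_measurable _ (caratheodory_type mu) B) => k.
  exact: mu_open (oB k).
apply: (@le_trans _ _ (\sum_(0 <= i <oo) sect_cap (E i `*` Q (tt i)))).
  apply: sect_cap_bigcup => z []; rewrite /preimage /= (seqDU_bigcup_eq B) => -[i _ Ei] nbad.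
  exists i => //; split => //=; apply: contrapT => nQ; apply: nbad.
  have := subset_seqDU Ei; rewrite /B; case: ifPn => // il; rewrite -ball_normE /= => tz.
  by exists i => //; split => //=; exact: ltW.
apply: (@le_trans _ _ (\sum_(0 <= i <oo) (C * eta)%:E * mu (E i))).
  apply: lee_nneseries => i _; first by move=> _; exact: sect_cap_ge0.
  by have [_ _] := QP (tt i); apply.
rewrite nneseriesZl; last by move=> i _; exact: outer_measure_ge0.
have -> : \sum_(0 <= i <oo) mu (E i) = mu (\bigcup_i E i).
  have := @measure_bigcup _ _ _ (mu : {measure set (caratheodory_type mu) -> \bar R}) setT E.
  move=> ->; [|by move=> i _; exact: mE|exact: trivIset_seqDU].
  by apply: eq_eseriesl => i; rewrite in_setT.
apply: (@le_trans _ _ ((C * eta)%:E * M%:E)).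
  apply: lee_wpmul2l; first by rewrite lee_fin mulr_ge0// ltW.
  by apply: le_trans muM; exact: le_outer_measure.
rewrite -EFinM lee_fin mulrAC -ler_pdivlMl ?mulr_gt0//.
by rewrite mulrC ge_min lexx orbT.
Qed.

(** A positive capacity would give a compact [K] inside [A] all of whose open neighbourhoods have
    capacity above some [a > 0], against [compact_sect_cap]. *)
Lemma borel_sect_cap (A K0 : set (V * Y)) : borel A -> A `<=` K0 -> compact K0 ->
  (forall t, ball_null q (xsection A t)) -> sect_cap A = 0.
Proof.
move=> bA AK0 cK0 Anull; apply/eqP; rewrite eq_le sect_cap_ge0 andbT leNgt.
apply/negP => A0.
have [a [a0 aA]] : exists a : R, (0 < a)%R /\ a%:E < sect_cap A.
  move: A0; case: (sect_cap A) => [b| |] //; last by exists 1%R; rewrite ltey.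
  by rewrite lte_fin => b0; exists (b / 2)%R; rewrite divr_gt0// lte_fin ltr_pdivrMr// ltr_pMr// ltr1n.
have cl0 : closed K0 by apply: compact_closed cK0; exact: norm_hausdorff.
have [|K [cK KA KW]] := @choquet_capacitability R (V * Y)%type sect_cap sect_cap_sub _ A K0 a
  (borel_souslin bA) AK0 cK0 cl0 aA.
  move=> F b FS Fb.
  exact: (@net_cap_nondecreasing _ (caratheodory_type mu) R mu Y (cell N) (level N)
    net_weight (@cell_nested _ _ N) net_weight_ge0 F b FS Fb).
have [|W [oW /(KW _ oW) aW Wa]] := compact_sect_cap cK a0.
  move=> t; apply: ball_null_sub (Anull t) => y; rewrite /xsection/= !inE; exact: KA.
by move: aW; rewrite ltNge Wa.
Qed.

Lemma borel_sect_cover (A K0 : set (V * Y)) (a : R) : borel A -> A `<=` K0 ->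
  compact K0 -> (forall t, ball_null q (xsection A t)) -> (0 < a)%R ->
  exists e : nat -> set V, [/\ forall i, mu.-caratheodory (e i),
    forall t y, A (t, y) -> exists i, e i t /\ cell N i y &
    \sum_(0 <= i <oo) (net_weight i)%:E * mu (e i) <= a%:E].
Proof.
move=> bA AK0 cK0 Anull a0.
have : sect_cap A < a%:E by rewrite (borel_sect_cap bA AK0 cK0 Anull) lte_fin.
move=> /(net_cap_family net_weight_ge0)[e [me Ae ea]].
by exists e; split => // t y /Ae.
Qed.

End SectionwiseNull.

(** * Borel sets and the content of a single ball *)

Section Borel.
Context {T : topologicalType}.
Implicit Types A : set T.

Lemma borel_open A : open A -> borel A.
Proof. by move=> oA; apply: sub_sigma_algebra. Qed.

Lemma borelC A : borel A -> borel (~` A).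
Proof.
have [_ h _] := smallest_sigma_algebra [set: T] [set U : set T | open U].
by move=> /h; rewrite setTD.
Qed.

Lemma borel_bigcup (F : nat -> set T) : (forall n, borel (F n)) ->
  borel (\bigcup_n F n).
Proof.
by have [_ _ h] := smallest_sigma_algebra [set: T] [set U : set T | open U]; exact: h.
Qed.

Lemma borel_bigcap (F : nat -> set T) : (forall n, borel (F n)) ->
  borel (\bigcap_n F n).
Proof.
move=> bF; rewrite -[X in borel X]setCK setC_bigcap; apply: borelC.
by apply: borel_bigcup => n; exact: borelC.
Qed.

Lemma borelI A (B : set T) : borel A -> borel B -> borel (A `&` B).
Proof.
move=> bA bB; have -> : A `&` B = \bigcap_n (if n is 0%N then A else B).
  apply/seteqP; split=> [x [Ax Bx] [|n] _//|x h].
  by split; [exact: (h 0%N)|exact: (h 1%N)].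
by apply: borel_bigcap => -[].
Qed.

Lemma borelD A (B : set T) : borel A -> borel B -> borel (A `\` B).
Proof. by move=> bA bB; rewrite setDE; apply: borelI => //; exact: borelC. Qed.

Lemma borel_closed A : closed A -> borel A.
Proof.
by move=> cA; rewrite -[A]setCK; apply: borelC; apply: borel_open; exact: closed_openC.
Qed.

End Borel.

Lemma open_prod {S T : topologicalType} (A : set S) (B : set T) :
  open A -> open B -> open (A `*` B).
Proof.
move=> oA oB; apply: (@openI _ (fst @^-1` A) (snd @^-1` B)).
  by apply: open_comp => // x _; exact: cvg_fst.
by apply: open_comp => // x _; exact: cvg_snd.
Qed.

Section BallGauge.
Context {R : realType} {V : normedModType R}.
Variable s : R.
Hypothesis s_gt0 : 0 < s.
Local Open Scope ereal_scope.

(** Covers are infinite sequences of balls of positive radius, so the ball is followed by concentric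
    ones of total cost at most [e]. *)
Lemma ball_gauge_ball (x : V) (r : R) : (0 < r)%R ->
  ball_gauge s (ball x r) <= (r `^ s)%:E.
Proof.
move=> r0; apply/lee_addgt0Pr => e e0.
have ei0 i : (0 < e / (2 ^ i.+1)%:R)%R by rewrite divr_gt0// ltr0n expn_gt0.
pose p i : V * R := (x, if i is j.+1 then (e / (2 ^ j.+1)%:R) `^ s^-1 else r)%R.
apply: (@le_trans _ _ (\sum_(0 <= i <oo) ((p i).2 `^ s)%:E)).
  apply: (@gauge_le _ _ _ _ _ _ _ p); split => [y xy|[|i]] //=; first by exists 0%N.
  by rewrite powR_gt0.
rewrite nneseries_recl// => [|i _]; last by rewrite lee_fin powR_ge0.
rewrite leeD2l// -(nneseries_addn 1) => [|i]; last by rewrite lee_fin powR_ge0.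
under eq_eseriesr do rewrite addn1 /= powRVK ?(ltW (ei0 _))//.
exact: (epsilon_trick0 predT (ltW e0)).
Qed.

Lemma ball_gauge0 : ball_gauge s (set0 : set V) = 0.
Proof.
apply/eqP; rewrite eq_le ball_gauge_ge0 andbT.
apply/lee_addgt0Pr => e e0; rewrite add0e.
have r0 : (0 < e `^ s^-1)%R by rewrite powR_gt0.
apply: (@le_trans _ _ (ball_gauge s (ball 0%R (e `^ s^-1)))); first exact: le_gauge.
by rewrite (le_trans (ball_gauge_ball _ r0))// powRVK// ltW.
Qed.

End BallGauge.

(** * Splitting off a set null on Lipschitz graphs *)

Section Decomposition.
Context {R : realType} {V Y : normedModType R}.
Variables (mu : {outer_measure set V -> \bar R}) (N : net Y).
Hypothesis mu_open : forall U : set V, open U -> mu.-caratheodory U.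
Hypothesis mu_fin : (mu setT < +oo)%E.
Variables (alpha q gam c rho : R) (T0 : set V).
Hypothesis alpha_gt0 : 0 < alpha.
Hypothesis q_gt0 : 0 < q.
Hypothesis gam_gt0 : 0 < gam.
Hypothesis c_gt0 : 0 < c.
Hypothesis rho_gt0 : 0 < rho <= 1.
Hypothesis mu_lower : forall t r, T0 t -> 0 < r <= rho ->
  ((c * r `^ alpha)%:E <= mu (ball t r))%E.
Variables (B K0 : set (V * Y)).
Hypothesis B_borel : borel B.
Hypothesis B_K0 : B `<=` K0.
Hypothesis K0_compact : compact K0.
Hypothesis B_T0 : forall z, B z -> T0 z.1.
Hypothesis B_null : forall t, ball_null q (xsection B t).
Local Open Scope ereal_scope.

Let M := fine (mu setT).

Let muM : mu setT = M%:E.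
Proof. by rewrite /M fineK// ge0_fin_numE ?outer_measure_ge0. Qed.

Let M_ge0 : (0 <= M)%R. Proof. by rewrite fine_ge0// outer_measure_ge0. Qed.

Lemma outer_measure_seq_le (I : eqType) (s : seq I) (A : I -> set V) (b : R) :
  (forall i, i \in s -> mu (A i) <= b%:E) ->
  mu [set t | exists2 i, i \in s & A i t] <= ((size s)%:R * b)%:E.
Proof.
elim: s => [|i s IH] Ab.
  rewrite mul0r (_ : [set t | _] = set0) ?outer_measure0//.
  by apply/seteqP; split => // t [].
apply: (@le_trans _ _ (mu (A i `|` [set t | exists2 i, i \in s & A i t]))).
  apply: le_outer_measure => t [k]; rewrite inE => /predU1P[->|ks] At; first by left.
  by right; exists k.
apply: (le_trans (outer_measureU2 _ _ _)).
rewrite /= -add1n natrD mulrDl mul1r EFinD; apply: leeD.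
  by apply: Ab; rewrite mem_head.
by apply: IH => k ks; apply: Ab; rewrite inE ks orbT.
Qed.

Let sep (r : R) (s : seq V) := pairwise (fun x y => r <= `|x - y|)%R s.

(** Balls of radius [r / 2] around [r]-separated points are disjoint, and open sets split the outer
    measure additively. *)
Let sep_measure (r b : R) (s : seq V) : sep r s ->
  (forall x, x \in s -> b%:E <= mu (ball x (r / 2)%R)) ->
  ((size s)%:R * b)%:E <= mu [set t | exists2 x, x \in s & ball x (r / 2) t].
Proof.
elim: s => [|x s IH] /=; first by move=> _ _; rewrite mul0r outer_measure_ge0.
rewrite /sep /= => /andP[/allP xs ss] sb.
set U := [set t | _].
rewrite (mu_open (ball_open x (r / 2)) U).
rewrite -add1n natrD mulrDl mul1r EFinD; apply: leeD.
  rewrite (_ : U `&` _ = ball x (r / 2)); first by apply: sb; rewrite mem_head.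
  by apply/seteqP; split=> [t []//|t xt]; split => //; exists x => //; rewrite mem_head.
apply: le_trans (IH ss _) _; first by move=> y ys; apply: sb; rewrite inE ys orbT.
apply: le_outer_measure => t [y ys yt]; split; first by exists y => //; rewrite inE ys orbT.
have := xs y ys; rewrite leNgt => + xt; move=> /negP; apply.
move: xt yt; rewrite -ball_normE /= => xt yt.
rewrite (le_lt_trans (ler_distD t _ _))// (splitr r) ltrD// distrC//.
Qed.

(** A separated family in [T0] of maximal cardinality is an [r]-net. Lower regularity and finite
    total mass bound the cardinality, so a maximal family exists. *)
Lemma separated_net (r : R) : (0 < r <= rho)%R -> exists s : seq V,
  (forall t, T0 t -> exists2 x, x \in s & ball x r t) /\
  ((size s)%:R * (c * (r / 2) `^ alpha) <= M)%R.
Proof.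
move=> /andP[r0 rrho].
have b0 : (0 < c * (r / 2) `^ alpha)%R by rewrite mulr_gt0// powR_gt0// divr_gt0.
pose P m := `[< exists s, [/\ size s = m, sep r s & forall x, x \in s -> T0 x] >].
have sbound s : sep r s -> (forall x, x \in s -> T0 x) ->
    ((size s)%:R * (c * (r / 2) `^ alpha) <= M)%R.
  move=> rs sT; rewrite -lee_fin -muM; apply: le_trans (sep_measure rs _) _.
    move=> x /sT Tx; apply: mu_lower => //.
    rewrite divr_gt0//= (le_trans _ rrho)// ler_pdivrMr// ler_peMr ?ler1n//.
    exact: ltW.
  exact: le_outer_measure.
have exP : exists m, P m by exists 0%N; apply/asboolP; exists [::].
have ubP m : P m -> (m <= `|Num.ceil (M / (c * (r / 2) `^ alpha))|)%N.
  move=> /asboolP[s [<- rs sT]]; have := sbound s rs sT.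
  rewrite -ler_pdivlMr// => h.
  rewrite -(ler_nat R) natr_absz ger0_norm ?ceil_ge0 ?(lt_le_trans (ltrN10 _)) ?divr_ge0 ?(ltW b0)//.
  exact: le_trans h (ceil_ge _).
case: (ex_maxnP exP ubP) => m /asboolP[s [sm rs sT]] mmax.
exists s; split; last exact: sbound.
move=> t Tt; apply: contrapT => nx.
suff /mmax : P m.+1 by rewrite ltnn.
apply/asboolP; exists (t :: s); split; first by rewrite /= sm.
  rewrite /sep /= [X in _ && X]rs andbT; apply/allP => x xs /=.
  rewrite leNgt; apply/negP => tx; apply: nx; exists x => //.
  by rewrite -ball_normE /= distrC.
by move=> x; rewrite inE => /predU1P[->|/sT].
Qed.

Lemma geometric_dyad_bound : exists G : R, (0 <= G)%R /\
  \sum_(0 <= j <oo) (dyad j `^ gam)%:E <= G%:E.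
Proof.
pose b : R := (2^-1 `^ gam)%R.
have b1 : (b < 1)%R.
  have := @powR_lt_base R gam 2^-1 1 gam_gt0; rewrite powR1; apply.
    by rewrite invr_ge0.
  by rewrite invf_lt1// ltr1n.
have b0 : (0 <= b)%R by exact: powR_ge0.
exists (1 - b)^-1%R; split; first by rewrite invr_ge0 subr_ge0 ltW.
have bE j : (dyad j `^ gam = b ^+ j)%R.
  elim: j => [|j IH]; first by rewrite /dyad !expr0 powR1.
  by rewrite exprS -IH /dyad exprS powRM ?exprn_ge0 ?invr_ge0.
apply: lime_le; first by apply: is_cvg_nneseries => j _ _; rewrite lee_fin powR_ge0.
near=> n; rewrite sumEFin lee_fin -div1r ler_pdivlMr ?subr_gt0//.
under eq_bigr do rewrite bE.
suff -> : ((\sum_(0 <= j < n) b ^+ j) * (1 - b) = 1 - b ^+ n)%R.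
  by rewrite lerBlDr lerDl exprn_ge0.
elim: (n) => [|m IH]; first by rewrite big_nil mul0r expr0 subrr.
by rewrite big_nat_recr//= mulrDl IH mulrBr mulr1 -exprSr addrA subrK.
Unshelve. all: by end_near. Qed.

(** Here [eps] bounds the cost of the measurable cover and [delta] is the density threshold. The set
    [U] is chosen before [f] and [L], so it serves all Lipschitz graphs at once. *)
Lemma good_boxes : exists C1 : R, exists C2 : R -> R, (0 < C1)%R /\
  forall delta eps : R, (0 < delta)%R -> (0 < eps)%R ->
  exists U : set (V * Y), [/\ open U,
    ball_gauge (alpha + q + gam) U <= (C1 * eps / delta)%:E &
    forall (f : V -> Y) (L : R), (forall s t, `|f s - f t| <= L * `|s - t|)%R ->
      mu [set t | B (t, f t) /\ ~ U (t, f t)] <= (C2 L * delta)%:E].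
Proof.
have [rho0 rho1] := andP rho_gt0.
pose r j : R := (rho * dyad j)%R.
have r0 j : (0 < r j)%R by rewrite mulr_gt0// dyad_gt0.
have rd j : (r j <= dyad j)%R by rewrite ler_piMl// ltW// dyad_gt0.
have rrho j : (0 < r j <= rho)%R by rewrite r0/= ler_piMr ?dyad_le1// ltW.
have /choice[s sP] j := separated_net (rrho j).
have /choice[Nc NcP] L := cell_count N L.
have [Gm [Gm0 GmP]] := geometric_dyad_bound.
pose M' := (M / (c * (rho / 2) `^ alpha))%R.
have c'0 : (0 < c * (rho / 2) `^ alpha)%R by rewrite mulr_gt0// powR_gt0// divr_gt0.
have sM j : ((size (s j))%:R * dyad j `^ alpha <= M')%R.
  rewrite ler_pdivlMr//; apply: le_trans (sP j).2.
  rewrite -mulrA ler_wpM2l//.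
  rewrite mulrCA ler_wpM2l ?(ltW c_gt0)// -powRM ?(ltW (dyad_gt0 _)) ?divr_ge0 ?(ltW rho0)//.
  by rewrite /r mulrA (mulrC rho).
pose e0 : R := (alpha + q + gam)%R.
exists (2 `^ e0)%R, (fun L => (Nc `|L|)%:R * M' * Gm)%R; split; first exact: powR_gt0.
move=> delta eps delta0 eps0.
have [e [me Be ecost]] := borel_sect_cover N mu_open mu_fin q_gt0 B_borel B_K0
  K0_compact B_null eps0.
pose b j a : set V := if (a < size (s j))%N then ball (nth 0%R (s j) a) (r j) else set0.
pose I j := seqDU (b j).
have mI j a : mu.-caratheodory (I j a).
  apply: (@seqDU_measurable _ (caratheodory_type mu) (b j)) => k.
  by apply: mu_open; rewrite /b; case: ifP => _; [exact: ball_open|exact: open0].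
have Ib j a t : I j a t -> (a < size (s j))%N /\ ball (nth 0%R (s j) a) (r j) t.
  by move=> h; have := subset_seqDU h; rewrite /b; case: ifP.
have T0I j t : T0 t -> exists a, I j a t.
  move=> /(sP j).1[x xs xt].
  have : (\bigcup_a b j a) t.
    by exists (index x (s j)) => //; rewrite /b index_mem xs nth_index.
  by rewrite seqDU_bigcup_eq => -[a _ ?]; exists a.
(* [I j a] are disjoint pieces of [T0] of size about [2^-j], and [tau j] is the
   threshold above which a box is kept. *)
pose tau j : R := (delta * (dyad j `^ gam * dyad j `^ alpha))%R.
pose good i a := (a < size (s (level N i)))%N /\
  (tau (level N i))%:E <= mu (e i `&` I (level N i) a).
have /choice[y yP] i : exists y, cell N i !=set0 -> cell N i y.
  by have [[y Ey]|nE] := pselect (cell N i !=set0); [exists y|exists 0%R].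
pose box i a : set (V * Y) := ball (nth 0%R (s (level N i)) a) (r (level N i)) `*`
  ball (y i) (2 * dyad (level N i))%R.
pose U i a := if pselect (good i a) then box i a else set0.
have goodU i a : good i a -> U i a = box i a by rewrite /U; case: pselect.
have badU i a : ~ good i a -> U i a = set0 by rewrite /U; case: pselect.
exists (\bigcup_i \bigcup_a U i a); split.
- apply: bigcup_open => i _; apply: bigcup_open => a _.
  have [g|ng] := pselect (good i a); last by rewrite badU//; exact: open0.
  by rewrite goodU//; apply: open_prod; exact: ball_open.
- have e00 : (0 < e0)%R by rewrite addr_gt0// addr_gt0.
  (* The threshold makes the cost [(2 * dyad j) ^ e0] of a kept box equal to [2 ^ e0 / delta] times
     its weight times [tau j], hence controlled by the mass of [e i] over the piece. *)
  have gU i a : ball_gauge e0 (U i a) <=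
      (2 `^ e0 / delta * net_weight N q i)%:E * mu (e i `&` I (level N i) a).
    have [g|ng] := pselect (good i a); last first.
      rewrite badU// ball_gauge0// mule_ge0// lee_fin mulr_ge0 ?divr_ge0 ?powR_ge0//.
      exact: ltW.
    rewrite (goodU _ _ g) /box; case: g => [al taule]; set j := level N i in al taule *.
    have d0 : (0 < 2 * dyad j :> R)%R by rewrite mulr_gt0// dyad_gt0.
    apply: (@le_trans _ _ (ball_gauge e0 (ball (nth 0%R (s j) a, y i) (2 * dyad j)%R))).
      apply: le_gauge => z [/= z1 z2]; split => //=.
      apply: le_ball z1; apply: (le_trans (rd j)).
      by rewrite ler_peMl ?ler1n// ltW// dyad_gt0.
    apply: (le_trans (ball_gauge_ball e00 _ d0)).
    apply: (@le_trans _ _ ((2 `^ e0 / delta * net_weight N q i)%:E * (tau j)%:E)).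
      rewrite -EFinM lee_fin powRM ?(ltW (dyad_gt0 _))// /net_weight -/j /tau.
      rewrite -!mulrA ler_wpM2l ?powR_ge0// mulrCA mulKf ?gt_eqF//.
      have dj : (dyad j != 0 :> R)%R by rewrite gt_eqF// dyad_gt0.
      rewrite /e0 powRD ?dj ?implybT// powRD ?dj ?implybT//.
      by rewrite -mulrA mulrCA (mulrC (dyad j `^ alpha)%R).
    apply: lee_wpmul2l => //; rewrite lee_fin mulr_ge0 ?powR_ge0// divr_ge0 ?powR_ge0//.
    exact: ltW.
  apply: (@le_trans _ _ (\sum_(0 <= i <oo) \sum_(0 <= a <oo) ball_gauge e0 (U i a))).
    apply: (@le_trans _ _ (\sum_(0 <= i <oo) ball_gauge e0 (\bigcup_a U i a))).
      exact: ball_gauge_bigcup.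
    apply: lee_nneseries => i _.
      by move=> _; exact: ball_gauge_ge0.
    exact: ball_gauge_bigcup.
  apply: (@le_trans _ _ (\sum_(0 <= i <oo)
      (2 `^ e0 / delta)%:E * ((net_weight N q i)%:E * mu (e i)))).
    apply: lee_nneseries => i _.
      move=> _; apply: nneseries_ge0 => a _ _.
      exact: ball_gauge_ge0.
    rewrite muleA -EFinM.
    apply: (@le_trans _ _ (\sum_(0 <= a <oo) (2 `^ e0 / delta * net_weight N q i)%:E *
        mu (e i `&` I (level N i) a))).
      apply: lee_nneseries => a _; last exact: gU.
      by move=> _; exact: ball_gauge_ge0.
    rewrite nneseriesZl; last by move=> a _; exact: outer_measure_ge0.
    apply: lee_wpmul2l.
      by rewrite lee_fin mulr_ge0 ?divr_ge0 ?powR_ge0//; exact: ltW.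
    have mS a : setT a -> (caratheodory_display mu).-measurable
        (e i `&` I (level N i) a : set (caratheodory_type mu)).
      by move=> _; apply: measurableI; [exact: me|exact: mI].
    have tS : trivIset setT (fun a => e i `&` I (level N i) a).
      by apply: trivIset_setIl; exact: trivIset_seqDU.
    have := @measure_bigcup _ _ _ (mu : {measure set (caratheodory_type mu) -> \bar R})
      setT _ mS tS.
    rewrite (eq_eseriesl (Q := xpredT)); last by move=> a; rewrite in_setT.
    by move=> <-; apply: le_outer_measure => t [a _ []].
  rewrite nneseriesZl; last first.
    by move=> i _; rewrite mule_ge0// lee_fin net_weight_ge0.
  rewrite [in leRHS]mulrAC [in leRHS]EFinM; apply: lee_wpmul2l => //.
  by rewrite lee_fin divr_ge0 ?powR_ge0// ltW.
move=> f L fL.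
(* A list containing the cells of level [p.1] that the graph of [f] can meet over the ball around
   centre number [p.2]; its length is bounded independently of the level. *)
have /choice[S0 S0P] p := NcP `|L|%R p.1 (f (nth 0%R (s p.1) p.2)).
pose A j a i := if pselect (~ good i a) then e i `&` I j a else set0.
have goodA j a i : good i a -> A j a i = set0 by rewrite /A; case: pselect.
have badA j a i : ~ good i a -> A j a i = e i `&` I j a by rewrite /A; case: pselect.
pose F j := [set t | exists2 a, a \in iota 0 (size (s j)) &
   [set t | exists2 i, i \in S0 (j, a) & A j a i t] t].
apply: (@le_trans _ _ (\sum_(0 <= j <oo) mu (F j))).
  apply: le_trans (outer_measure_sigma_subadditive mu F).
  apply: le_outer_measure => t [Bt nU].
  have [i [ei Di]] := Be _ _ Bt.
  have [a Ia] := T0I (level N i) t (B_T0 Bt).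
  have [al at_] := Ib _ _ _ Ia.
  have Ui : box i a (t, f t).
    split => //=; rewrite -ball_normE /=.
    apply: (le_lt_trans (cell_diam (yP i _) Di)); first by exists (f t).
    by rewrite mulrC ltr_pMr ?dyad_gt0// ltr1n.
  exists (level N i) => //; exists a; first by rewrite mem_iota.
  exists i.
    have [_ _ h] := S0P (level N i, a); apply: (h _ (f t)) => //=.
    apply: (le_trans (fL _ _)); apply: (@le_trans _ _ (`|L| * `|t - nth 0 (s (level N i)) a|)%R).
      by rewrite ler_wpM2r// ler_norm.
    rewrite ler_wpM2l// (le_trans _ (rd _))// ltW//.
    by move: at_; rewrite -ball_normE /= distrC.
  rewrite badA// => gi.
  by apply: nU; exists i => //; exists a => //; rewrite goodU.
have M'0 : (0 <= M')%R by rewrite divr_ge0 ?(ltW c'0).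
(* At level [j] there are at most [M' / dyad j ^ alpha] pieces, boundedly many cells over each, and
   mass at most [tau j] per discarded box. The remaining factor [dyad j ^ gam] makes the sum over
   the levels converge. *)
apply: (@le_trans _ _ (\sum_(0 <= j <oo)
    ((Nc `|L|%R)%:R * M' * delta)%:E * (dyad j `^ gam)%:E)).
  apply: lee_nneseries => j _; first by move=> _; exact: outer_measure_ge0.
  have tau0 : (0 <= tau j)%R by rewrite mulr_ge0 ?mulr_ge0 ?powR_ge0// ltW.
  apply: (le_trans (@outer_measure_seq_le _ (iota 0 (size (s j)))
     (fun a => [set t | exists2 i, i \in S0 (j, a) & A j a i t])
     ((Nc `|L|%R)%:R * tau j)%R _)).
    move=> a _; have [Sle Slev _] := S0P (j, a).
    apply: (le_trans (@outer_measure_seq_le _ (S0 (j, a)) (A j a) (tau j) _)).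
      move=> i iS; have [g|ng] := pselect (good i a).
        by rewrite goodA// outer_measure0 lee_fin.
      rewrite badA//; have [aj|ja] := ltnP a (size (s j)); last first.
        rewrite (_ : _ `&` _ = set0) ?outer_measure0 ?lee_fin//.
        apply/seteqP; split => // t [_ /Ib[]]; by rewrite ltnNge ja.
      rewrite leNgt; apply/negP => h; apply: ng.
      by rewrite /good (Slev i iS); split => //; exact: ltW.
    by rewrite lee_fin ler_wpM2r// ler_nat.
  rewrite size_iota -EFinM lee_fin /tau.
  rewrite [leLHS](_ : _ = (Nc `|L|)%:R * delta * dyad j `^ gam *
      ((size (s j))%:R * dyad j `^ alpha))%R; last first.
    by ring.
  rewrite [leRHS](_ : _ = (Nc `|L|)%:R * delta * dyad j `^ gam * M')%R; last first.
    by ring.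
  by rewrite ler_wpM2l// mulr_ge0 ?powR_ge0// mulr_ge0// ltW.
rewrite nneseriesZl; last by move=> j _; rewrite lee_fin powR_ge0.
rewrite [leRHS](_ : _ = ((Nc `|L|%R)%:R * M' * delta)%:E * Gm%:E); last first.
  by rewrite -EFinM mulrAC.
by apply: lee_wpmul2l => //; rewrite lee_fin mulr_ge0 ?(ltW delta0)// mulr_ge0.
Qed.

(** [G] is the part of [B] outside the upper limit of the kept sets. A graph point in [G] is
    discarded at all late stages, whose exceptional measures tend to 0; the upper limit is covered
    by tails with summable contents. *)
Lemma lipschitz_null_decomposition : exists G : set (V * Y), [/\ borel G, G `<=` B,
  forall (f : V -> Y) (L : R), (forall s t, `|f s - f t| <= L * `|s - t|)%R ->
    mu [set t | G (t, f t)] = 0 &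
  ball_null (alpha + q + gam) (B `\` G)].
Proof.
have [C1 [C2 [C10 step]]] := good_boxes.
have /choice[U UP] m := step (dyad m) (dyad m * dyad m)%R (dyad_gt0 m)
  (mulr_gt0 (dyad_gt0 m) (dyad_gt0 m)).
(* Take delta = 2^-m and eps = 4^-m: the bounds 2^-m are summable. *)
pose F := \bigcap_k \bigcup_m U (m + k)%N.
have bF : borel F.
  apply: borel_bigcap => k; apply: borel_bigcup => m; apply: borel_open.
  by have [] := UP (m + k)%N.
have e00 : (0 < alpha + q + gam)%R by rewrite addr_gt0// addr_gt0.
exists (B `\` F); split.
- exact: borelD.
- by move=> z [].
- move=> f L fL; pose bad m := [set t | B (t, f t) /\ ~ U m (t, f t)].
  apply/eqP; rewrite eq_le outer_measure_ge0 andbT.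
  pose T k := \bigcap_m bad (m + k)%N.
  apply: (@le_trans _ _ (mu (\bigcup_k T k))).
    apply: le_outer_measure => t [Bt /existsNP[k]].
    move=> /not_implyP[_ nU]; exists k => // m _; split => // Ut.
    by apply: nU; exists m.
  apply: (le_trans (outer_measure_sigma_subadditive mu T)).
  rewrite eseries0// => k _ _; apply/eqP; rewrite eq_le outer_measure_ge0 andbT.
  apply/lee_addgt0Pr => e e1; rewrite add0e.
  have D0 : (0 < e / (`|C2 L| + 1))%R by rewrite divr_gt0// ltr_wpDl.
  have [m _ hm] := near_infty_natSinv_expn_lt (PosNum D0).
  apply: (@le_trans _ _ (mu (bad (maxn m k)))).
    apply: le_outer_measure => t; move=> /(_ (maxn m k - k)%N I).
    by rewrite subnK ?leq_maxr.
  have [_ _ /(_ f L fL)/le_trans] := UP (maxn m k); apply.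
  have := hm (maxn m k) (leq_maxl _ _); rewrite /= div1r -exprVn -/(dyad _).
  rewrite ltr_pdivlMr ?ltr_wpDl// => h.
  rewrite lee_fin (le_trans _ (ltW h))// mulrC ler_wpM2l ?(ltW (dyad_gt0 _))//.
  by rewrite (le_trans (ler_norm _))// lerDl.
apply/eqP; rewrite eq_le ball_gauge_ge0 andbT.
apply/lee_addgt0Pr => e e1; rewrite add0e.
(* Once [2 * C1 * dyad k < e], the content of [U (m + k)] is at most [e / 2 ^ m.+1]. *)
have D0 : (0 < e / (2 * C1))%R by rewrite divr_gt0// mulr_gt0.
have [k _ hk] := near_infty_natSinv_expn_lt (PosNum D0).
have := hk k (leqnn k); rewrite /= div1r -exprVn -/(dyad _) => {}hk.
apply: (@le_trans _ _ (ball_gauge (alpha + q + gam) (\bigcup_m U (m + k)%N))).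
  apply: le_gauge => z [Bz nF]; have Fz : F z by apply: contrapT => ?; apply: nF.
  exact: Fz.
apply: (le_trans (ball_gauge_bigcup _ _)).
apply: (le_trans _ (epsilon_trick0 xpredT (ltW e1))).
apply: lee_nneseries => m _; first by move=> _; exact: ball_gauge_ge0.
have [_ /le_trans + _] := UP (m + k)%N; apply.
rewrite lee_fin mulrA mulfK ?gt_eqF ?dyad_gt0//.
rewrite [dyad _](_ : _ = (dyad m * dyad k)%R); last by rewrite /dyad exprD.
move: hk; rewrite ltr_pdivlMr ?mulr_gt0// => hk.
rewrite [(2 ^ m.+1)%:R](_ : _ = 2 ^+ m.+1)%R ?natrX// -exprVn exprS.
rewrite /dyad mulrCA (mulrC _ (2^-1 * _))%R -mulrA (mulrCA 2^-1)%R.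
rewrite ler_wpM2l ?exprn_ge0 ?invr_ge0//.
by rewrite ler_pdivlMl// mulrC -mulrA (mulrC C1) mulrA in hk *; exact: ltW.
Qed.

End Decomposition.

(** * Marstrand's inequality *)

Section Chebyshev.
Context d (X : measurableType d) (R : realType) (mu : {measure set X -> \bar R}).
Variables (B : nat -> set X) (w : nat -> R) (eta : R).
Hypothesis B_measurable : forall i, measurable (B i).
Hypothesis w_ge0 : forall i, 0 <= w i.
Hypothesis eta_gt0 : 0 < eta.
Local Open Scope ereal_scope.

Let term i (t : X) : \bar R := (w i * \1_(B i) t)%:E.

(** [S] may fail to be measurable, so it is enclosed in a superlevel set of the series, to which
    Chebyshev's inequality applies. *)
Lemma chebyshev_series (S : set X) :
  (forall t, S t -> eta%:E <= \sum_(0 <= i <oo) (w i * \1_(B i) t)%:E) ->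
  exists S', [/\ measurable S', S `<=` S' &
    eta%:E * mu S' <= \sum_(0 <= i <oo) (w i)%:E * mu (B i)].
Proof.
move=> Seta.
have term_ge0 i t : 0 <= term i t by rewrite lee_fin mulr_ge0.
have mterm i : measurable_fun setT (term i).
  by apply/measurable_EFinP; apply: measurable_funM.
pose g t := \sum_(0 <= i <oo) term i t.
have mg : measurable_fun setT g.
  rewrite (_ : g = fun t => \sum_(0 <= i <oo | i \in xpredT) term i t).
    by apply: ge0_emeasurable_sum.
  by apply/funext => t; apply: eq_eseriesl.
pose S' := [set t | eta%:E <= g t].
have mS' : measurable S'.
  by rewrite -[S']setTI; exact: emeasurable_fun_c_infty.
exists S'; split=> //.
have <- : \int[mu]_t g t = \sum_(0 <= i <oo) (w i)%:E * mu (B i).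
  rewrite integral_nneseries//; apply: eq_eseriesr => i _.
  rewrite (eq_integral (fun t => (w i)%:E * (\1_(B i) t)%:E))//.
  rewrite ge0_integralZl//; first by rewrite integral_indic// setIT.
    by apply/measurable_EFinP.
  by rewrite lee_fin.
rewrite -(integral_cst mu mS').
apply: (@le_trans _ _ (\int[mu]_(t in S') g t)).
  apply: ge0_le_integral => //; first by move=> t _ /=; rewrite lee_fin ltW.
  exact: measurable_funTS.
by apply: ge0_subset_integral => // t _; exact: nneseries_ge0.
Qed.

End Chebyshev.

Section MarstrandInequality.
Context {R : realType} {V Y : normedModType R}.
Variables (mu : {outer_measure set V -> \bar R}).
Hypothesis mu_open : forall U : set V, open U -> mu.-caratheodory U.
Variables (alpha C r0 : R).
Hypothesis alpha_gt0 : 0 < alpha.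
Hypothesis C_ge0 : 0 <= C.
Hypothesis r0_gt0 : 0 < r0.
Hypothesis mu_upper : forall x r, 0 < r <= r0 -> (mu (ball x r) <= (C * r `^ alpha)%:E)%E.
Variable A : set (V * Y).
Local Open Scope ereal_scope.

Let small_cover (s e : R) : (0 < s)%R -> (0 < e)%R -> ball_null s A ->
  exists x : nat -> V * Y, exists r : nat -> R, [/\ forall i, (0 < r i <= r0)%R,
    A `<=` \bigcup_i ball (x i) (r i) & \sum_(0 <= i <oo) (r i `^ s)%:E <= e%:E].
Proof.
move=> s0 e0 /ball_nullP A0.
have m0 : (0 < Num.min e (r0 `^ s))%R by rewrite lt_min e0 powR_gt0.
have [x [r [rp Axr xre]]] := A0 _ m0; exists x, r; split=> //.
  move=> i; rewrite rp leNgt; apply/negP => /(powR_lt_base s0 (ltW r0_gt0)).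
  apply/negP; rewrite -leNgt -lee_fin; apply: le_trans (nneseries_term_le i _ xre) _.
    by move=> k; rewrite lee_fin powR_ge0.
  by rewrite lee_fin ge_min lexx orbT.
by rewrite (le_trans xre)// lee_fin ge_min lexx.
Qed.

Lemma base_null : ball_null alpha A -> mu (fst @` A) = 0.
Proof.
move=> A0; apply/eqP; rewrite eq_le outer_measure_ge0 andbT.
apply/lee_addgt0Pr => e e0; rewrite add0e.
have d0 : (0 < e / (C + 1))%R by rewrite divr_gt0// ltr_wpDl.
have [x [r [rr Axr xre]]] := small_cover alpha_gt0 d0 A0.
apply: (@le_trans _ _ (mu (\bigcup_i ball (x i).1 (r i)))).
  by apply: le_outer_measure => _ [z /Axr[i _ [zi _]] <-]; exists i.
apply: (le_trans (outer_measure_sigma_subadditive mu (fun i => ball (x i).1 (r i)))).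
apply: (@le_trans _ _ (\sum_(0 <= i <oo) C%:E * (r i `^ alpha)%:E)).
  by apply: lee_nneseries => i _; [move=> _; exact: outer_measure_ge0|exact: mu_upper].
rewrite nneseriesZl; last by move=> i _; rewrite lee_fin powR_ge0.
apply: (@le_trans _ _ (C%:E * (e / (C + 1))%:E)); first exact: lee_wpmul2l.
rewrite -EFinM lee_fin mulrCA ler_piMr ?(ltW e0)//.
by rewrite ler_pdivrMr ?mul1r ?lerDl// ltr_wpDl.
Qed.

(** A cover of [A] by balls induces on the section at [t] a cover by the balls whose base contains
    [t]. The integral of its cost is at most [C] times the sum of the [r i ^ (alpha + q)], so
    Chebyshev's inequality makes the set of [t] with content at least [1 / k.+1] null. *)
Lemma sections_null (q : R) : (0 < q)%R -> ball_null (alpha + q) A ->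
  mu [set t | ~ ball_null q (xsection A t)] = 0.
Proof.
move=> q0 A0; apply/eqP; rewrite eq_le outer_measure_ge0 andbT.
pose S k := [set t | (k.+1%:R^-1 : R)%:E <= ball_gauge q (xsection A t)].
apply: (@le_trans _ _ (mu (\bigcup_k S k))).
  apply: le_outer_measure => t tA.
  have : 0 < ball_gauge q (xsection A t).
    by rewrite lt_def ball_gauge_ge0 andbT; apply/eqP.
  rewrite /bigcup /=; have := ball_gauge_ge0 q (xsection A t).
  rewrite /S /=; case: (ball_gauge q (xsection A t)) => [b| |] //; last first.
    by move=> _ _; exists 0%N => //=; rewrite leey.
  rewrite lte_fin => _ b0; have [m _ hm] := near_infty_natSinv_lt (PosNum b0).
  by exists m => //=; rewrite lee_fin ltW// hm/=.
apply: (le_trans (outer_measure_sigma_subadditive mu S)).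
rewrite eseries0// => k _ _; apply/eqP; rewrite eq_le outer_measure_ge0 andbT.
apply/lee_addgt0Pr => e e0; rewrite add0e.
have k0 : (0 < k.+1%:R^-1 :> R)%R by rewrite invr_gt0.
have C10 : (0 < C + 1)%R by rewrite ltr_wpDl.
have d0 : (0 < k.+1%:R^-1 * e / (C + 1))%R by rewrite divr_gt0// mulr_gt0.
have aq0 : (0 < alpha + q)%R by rewrite addr_gt0.
have [x [r [rr Axr xre]]] := small_cover aq0 d0 A0.
(* The product carries the maximum norm, so a ball of the product is the product of two balls of the
   same radius. *)
pose B i : set V := ball (x i).1 (r i).
have rp i : (0 < r i)%R by have /andP[] := rr i.
have [|i|t St|S' [mS' SS' cS']] := @chebyshev_series _ (caratheodory_type mu) R mu B
  (fun i => r i `^ q)%R _ _ _ k0 (S k).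
- by move=> i; apply: mu_open; exact: ball_open.
- exact: powR_ge0.
- apply: (le_trans St).
  apply: (@le_trans _ _ (ball_gauge q
      (\bigcup_i if pselect (B i t) then ball (x i).2 (r i) else set0))).
    apply: le_gauge => y; rewrite /xsection /= inE => /Axr[i _ [/= ti yi]].
    by exists i => //; case: pselect.
  apply: (le_trans (ball_gauge_bigcup _ _)).
  apply: lee_nneseries => i _; first by move=> _; exact: ball_gauge_ge0.
  case: pselect => Bt /=.
    by rewrite indicE mem_set// mulr1; exact: ball_gauge_ball.
  by rewrite ball_gauge0// indicE memNset// mulr0.
apply: (le_trans (le_outer_measure mu _ _ SS')).
rewrite -(@lee_pmul2l _ (k.+1%:R^-1)%:E) ?lte_fin// ?fin_numE//.
apply: (le_trans cS').
apply: (@le_trans _ _ (\sum_(0 <= i <oo) C%:E * (r i `^ (alpha + q))%:E)).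
  apply: lee_nneseries => i _; first by move=> _; rewrite mule_ge0// lee_fin powR_ge0.
  rewrite -EFinM powRD ?(gt_eqF (rp i)) ?implybT// mulrA mulrC EFinM.
  by apply: lee_wpmul2l; rewrite ?lee_fin ?powR_ge0//; exact: mu_upper.
rewrite nneseriesZl; last by move=> i _; rewrite lee_fin powR_ge0.
apply: (@le_trans _ _ (C%:E * (k.+1%:R^-1 * e / (C + 1))%:E)); first exact: lee_wpmul2l.
rewrite -!EFinM lee_fin mulrCA ler_piMr ?mulr_ge0 ?(ltW e0) ?(ltW k0)//.
by rewrite ler_pdivrMr// mul1r lerDl.
Qed.

End MarstrandInequality.

(** * Ahlfors-David regular sets *)

Section Restriction.
Context {R : realType} {V : Type} (mu : {outer_measure set V -> \bar R}) (S : set V).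
Local Open Scope ereal_scope.

Definition outer_restr (A : set V) : \bar R := mu (A `&` S).

Let outer_restr0 : outer_restr set0 = 0.
Proof. by rewrite /outer_restr set0I outer_measure0. Qed.

Let outer_restr_ge0 A : 0 <= outer_restr A.
Proof. exact: outer_measure_ge0. Qed.

Let le_outer_restr : {homo outer_restr : A B / A `<=` B >-> A <= B}.
Proof. by move=> A B AB; apply: le_outer_measure; exact: setSI. Qed.

Let outer_restr_sigma_subadditive : sigma_subadditive outer_restr.
Proof.
by move=> F; rewrite /outer_restr setI_bigcupl; exact: outer_measure_sigma_subadditive.
Qed.

HB.instance Definition _ := isOuterMeasure.Build R V outer_restr
  outer_restr0 outer_restr_ge0 le_outer_restr outer_restr_sigma_subadditive.

Lemma outer_restr_caratheodory U : mu.-caratheodory U -> outer_restr.-caratheodory U.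
Proof. by move=> mU X; rewrite /outer_restr (mU (X `&` S)) !(setIAC _ S). Qed.

End Restriction.

Lemma borel_preimage {S T : topologicalType} (f : S -> T) (A : set T) :
  continuous f -> borel A -> borel (f @^-1` A).
Proof.
move=> cf; suff : <<s [set U : set T | open U] >> `<=` [set A | borel (f @^-1` A)].
  by move=> h /h.
apply: smallest_sub => [|U oU]; last first.
  by apply: borel_open; apply: open_comp => // x _; exact: cf.
split=> [|D bD|F bF].
- by rewrite /= preimage_set0; apply: borel_open; exact: open0.
- by rewrite /= setTD preimage_setC; exact: borelC.
- by rewrite /= preimage_bigcup; exact: borel_bigcup.
Qed.

Section Euclidean.
Context {R : realType} (k : nat).
Local Open Scope ereal_scope.

Lemma hmeasure_open s (U : set 'rV[R]_k) : open U ->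
  (hmeasure (@edistv R k) s).-caratheodory U.
Proof.
apply: metric_outer_measure_open => A B rho rho0 h.
by apply: hmeasure_separated rho0 _ => a b Aa Bb; exact: le_trans (h a b Aa Bb) (edistv_ge _ _).
Qed.

(** A point of [T] is chosen in every cell that meets [T], and [t0] for the other indices; the cells
    of one level of mesh below [rho] already give the cover. *)
Lemma separable_cover (T : set 'rV[R]_k) (rho : R) : (0 < rho)%R -> T !=set0 ->
  exists tt : nat -> 'rV[R]_k, (forall i, T (tt i)) /\ T `<=` \bigcup_i ball (tt i) rho.
Proof.
move=> rho0 [t0 Tt0]; pose N := @dyadic_net R k.
have /choice[tt ttP] i : exists t, T t /\
    ((exists u, T u /\ cell N i u) -> cell N i t).
  have [[u [Tu Du]]|nu] := pselect (exists u, T u /\ cell N i u); first by exists u.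
  by exists t0.
exists tt; split=> [i|u Tu]; first by have [] := ttP i.
have [j _ hj] := near_infty_natSinv_expn_lt (PosNum rho0).
have := hj j (leqnn j); rewrite /= div1r -exprVn -/(dyad _) => {}hj.
have [i ij Du] := cell_exists N j u.
exists i => //; rewrite -ball_normE /= (le_lt_trans _ hj)// -ij.
by apply: (cell_diam _ Du); apply: (ttP i).2; exists u.
Qed.

End Euclidean.

Section ADRegular.
Context {R : realType} (k n : nat).
Variables (alpha : R) (T : set 'rV[R]_k) (c c' : R).
Hypothesis alpha_gt0 : 0 < alpha.
Hypothesis c_gt0 : 0 < c.
Hypothesis c'_gt0 : 0 < c'.
Hypothesis T_regular : forall (t : 'rV[R]_k) (r : R), T t -> 0 < r <= 1 ->
  ((c * r `^ alpha)%:E <= hmeasure (@edistv R k) alpha (T `&` [set u | edistv t u < r]%R)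
    <= (c' * r `^ alpha)%:E)%E.
Hypothesis T_neq0 : T !=set0.
Local Open Scope ereal_scope.
Local Notation V := 'rV[R]_k.
Local Notation Y := 'rV[R]_n.
Local Notation H := (hmeasure (@edistv R k) alpha).

Let Ck : R := (k%:R + 1)%R.

Let Ck_ge1 : (1 <= Ck)%R. Proof. by rewrite lerDr. Qed.

Let Ck_gt0 : (0 < Ck)%R. Proof. exact: lt_le_trans Ck_ge1. Qed.

Let Cn_gt0 : (0 < n%:R + 1 :> R)%R. Proof. by rewrite ltr_wpDl. Qed.

(* Euclidean balls of radius [Ck * r] contain maximum-norm balls of radius [r];
   all radii up to [4 * rho] thus fall into the range of [T_regular]. *)
Let rho : R := (4 * Ck)^-1%R.

Let rho_gt0 : (0 < rho)%R. Proof. by rewrite invr_gt0 mulr_gt0. Qed.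

Let Ck_rho : (Ck * (4 * rho) = 1)%R.
Proof. by rewrite /rho invfM mulVKf// divff// gt_eqF. Qed.

Let rho_le : (4 * rho <= 1)%R.
Proof.
by rewrite -[leRHS]Ck_rho ler_peMl// mulr_ge0// ltW.
Qed.

Let ad_lower t r : T t -> (0 < r <= 1)%R -> (c * r `^ alpha)%:E <= H (T `&` ball t r).
Proof.
move=> Tt r01; have /andP[h _] := T_regular Tt r01; apply: (le_trans h).
apply: le_hmeasure => u [Tu tu]; split=> //; rewrite -ball_normE /=.
exact: le_lt_trans (edistv_ge _ _) tu.
Qed.

Let ad_upper t r : T t -> (0 < r <= 4 * rho)%R ->
  H (T `&` ball t r) <= (c' * (Ck * r) `^ alpha)%:E.
Proof.
move=> Tt /andP[r0 r1]; have r01 : (0 < Ck * r <= 1)%R.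
  by rewrite mulr_gt0//= -[leRHS]Ck_rho ler_pM2l.
have /andP[_ h] := T_regular Tt r01; apply: le_trans h.
apply: le_hmeasure => u [Tu]; rewrite -ball_normE /= => tu; split=> //=.
by apply: (le_lt_trans (edistv_le _ _)); rewrite ltr_pM2l.
Qed.

(* [T] may have infinite measure, so the measure is localized. *)
Let local (t0 : V) := outer_restr (H : {outer_measure set V -> \bar R})
  (T `&` ball t0 (2 * rho)).

Let local_open t0 U : open U -> (local t0).-caratheodory U.
Proof. by move=> oU; apply: outer_restr_caratheodory; exact: hmeasure_open. Qed.

Let local_fin t0 : T t0 -> local t0 setT < +oo.
Proof.
move=> Tt0; rewrite /local /outer_restr setTI.
apply: (le_lt_trans (ad_upper Tt0 _)); last by rewrite ltey.
by rewrite mulr_gt0//= ler_pM2r// ler_nat.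
Qed.

(** Centres within [rho] of [t0] and radii at most [rho] keep the balls inside the localizing ball
    of radius [2 * rho]. *)
Let local_lower t0 t r : (T `&` ball t0 rho) t -> (0 < r <= rho)%R ->
  (c * r `^ alpha)%:E <= local t0 (ball t r).
Proof.
move=> [Tt tt0] /andP[r0 r1].
have r01 : (0 < r <= 1)%R.
  rewrite r0 (le_trans r1)// (le_trans _ rho_le)// ler_peMl ?ler1n// ltW//.
apply: (le_trans (ad_lower Tt r01)); apply: le_hmeasure => u [Tu tu].
split=> //; split=> //; move: tt0 tu; rewrite -!ball_normE /= => tt0 tu.
rewrite (le_lt_trans (ler_distD t _ _))// mulr_natl mulr2n ltrD//.
exact: lt_le_trans r1.
Qed.

(** The centre may lie outside [T]: a ball that meets [T] is contained in a ball of twice the radius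
    centred on [T], hence the factor 2. *)
Let local_upper t0 x r : (0 < r <= rho)%R ->
  local t0 (ball x r) <= (c' * (2 * Ck) `^ alpha * r `^ alpha)%:E.
Proof.
move=> /andP[r0 r1].
have [[u [Tu xu]]|nu] := pselect (exists u, T u /\ ball x r u); last first.
  rewrite /local /outer_restr (_ : _ `&` _ = set0).
    by rewrite outer_measure0 lee_fin !mulr_ge0 ?powR_ge0// ltW.
  by apply/seteqP; split=> // u [xu [Tu _]]; apply: nu; exists u.
apply: (@le_trans _ _ (H (T `&` ball u (2 * r)))).
  apply: le_hmeasure => v [xv [Tv _]]; split=> //.
  move: xu xv; rewrite -!ball_normE /= => xu xv.
  by rewrite (le_lt_trans (ler_distD x _ _))// mulr_natl mulr2n ltrD// distrC.
apply: (le_trans (ad_upper Tu _)).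
  by rewrite mulr_gt0//= (@le_trans _ _ (2 * rho)%R)// ?ler_pM2l// ler_pM2r// ler_nat.
by rewrite lee_fin -mulrA -powRM ?mulr_ge0 ?(ltW Ck_gt0) ?(ltW r0)// mulrA (mulrC 2%R).
Qed.

Let local_sub t0 E : E `<=` T `&` ball t0 rho -> H E = local t0 E.
Proof.
move=> ET; rewrite /local /outer_restr; congr (H _); apply/seteqP.
split=> [t Et|t []//]; have [Tt tt0] := ET _ Et; split=> //; split=> //.
by apply: le_ball tt0; rewrite ler_peMl ?ler1n// ltW.
Qed.

Let H_pieces (E : set V) : E `<=` T ->
  (forall t0, T t0 -> H (E `&` ball t0 rho) = 0) -> H E = 0.
Proof.
move=> ET E0; have [tt [Ttt Tcov]] := separable_cover rho_gt0 T_neq0.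
apply/eqP; rewrite eq_le hmeasure_ge0 andbT.
apply: (@le_trans _ _ (H (\bigcup_i (E `&` ball (tt i) rho)))).
  by apply: le_hmeasure => t Et; have [i _ ?] := Tcov _ (ET _ Et); exists i.
apply: (le_trans (hmeasure_sigma_subadditive _ _ _)).
by rewrite eseries0// => i _ _; exact: E0.
Qed.

(** [T] is a countable union of pieces of finite [alpha]-dimensional measure. *)
Lemma regular_hmeasure_null s : (alpha < s)%R -> hmeasure (@edistv R k) s T = 0.
Proof.
move=> als; have [tt [Ttt Tcov]] := separable_cover rho_gt0 T_neq0.
apply/eqP; rewrite eq_le hmeasure_ge0 andbT.
apply: (@le_trans _ _ (hmeasure (@edistv R k) s (\bigcup_i (T `&` ball (tt i) rho)))).
  by apply: le_hmeasure => t Et; have [i _ ?] := Tcov _ Et; exists i.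
apply: (le_trans (hmeasure_sigma_subadditive _ _ _)).
rewrite eseries0// => i _ _.
apply: (@hmeasure_exp_null _ _ _ (@edistv_ge R k) alpha) => //; first exact: ltW.
rewrite (@local_sub (tt i))//.
by apply: le_lt_trans (local_fin (Ttt i)); exact: le_outer_measure.
Qed.

Lemma regular_base_null (A : set (V * Y)) : base_proj A `<=` T ->
  ball_null alpha A -> H (base_proj A) = 0.
Proof.
move=> AT A0; apply: H_pieces => // t0 Tt0.
rewrite (@local_sub t0); last by move=> t [/AT].
apply/eqP; rewrite eq_le outer_measure_ge0 andbT.
rewrite -(base_null alpha_gt0 _ rho_gt0 (@local_upper t0) A0).
  by apply: le_outer_measure => t [].
by rewrite mulr_ge0 ?powR_ge0// ltW.
Qed.

Lemma regular_sections_null (A : set (V * Y)) (q : R) : base_proj A `<=` T ->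
  (0 < q)%R -> ball_null (alpha + q) A ->
  H [set t | ~ ball_null q (xsection A t)] = 0.
Proof.
move=> AT q0 A0.
have ZT : [set t | ~ ball_null q (xsection A t)] `<=` T.
  move=> t nA; apply: contrapT => nT; apply: nA; rewrite (_ : xsection A t = set0).
    exact: ball_gauge0.
  apply/seteqP; split=> // y; rewrite /xsection /= inE => Aty; apply: nT; apply: AT.
  by exists (t, y).
apply: H_pieces => // t0 Tt0.
rewrite (@local_sub t0); last by move=> t [/ZT].
apply/eqP; rewrite eq_le outer_measure_ge0 andbT.
rewrite -(sections_null (@local_open t0) alpha_gt0 _ rho_gt0 (@local_upper t0) q0 A0).
  by apply: le_outer_measure => t [].
by rewrite mulr_ge0 ?powR_ge0// ltW.
Qed.

(** The hull is a countable intersection of unions of balls whose total costs tend to 0. *)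
Lemma null_borel_hull (E : set V) : H E = 0 ->
  exists E', [/\ borel E', E `<=` E' & H E' = 0].
Proof.
move=> /(hmeasure_ball_null (@edistv_ge R k) alpha_gt0)/ball_nullP E0.
have /choice[x /choice[r xrP]] m : exists x, exists r : nat -> R,
    [/\ forall i, (0 < r i)%R, E `<=` \bigcup_i ball (x i) (r i) &
    \sum_(0 <= i <oo) (r i `^ alpha)%:E <= (m.+1%:R^-1)%:E].
  by apply: E0; rewrite invr_gt0.
exists (\bigcap_m \bigcup_i ball (x m i) (r m i)); split.
- apply: borel_bigcap => m; apply: borel_bigcup => i; apply: borel_open.
  exact: ball_open.
- by move=> t Et m _; have [_ + _] := xrP m; exact.
apply: (ball_null_hmeasure (@edistv_ge R k) (@edistv_le R k) Ck_gt0 alpha_gt0).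
apply/ball_nullP => e e0; have [m _ hm] := near_infty_natSinv_lt (PosNum e0).
have [r0 _ xre] := xrP m; exists (x m), (r m); split=> //.
  by move=> t /(_ m I).
by apply: (le_trans xre); rewrite lee_fin ltW// hm/=.
Qed.

Lemma Gamma_null_bigcup (G : nat -> set (V * Y)) :
  (forall i, Gamma_null alpha (G i)) -> Gamma_null alpha (\bigcup_i G i).
Proof.
move=> G0 f fL; apply/eqP; rewrite eq_le hmeasure_ge0 andbT.
apply: (@le_trans _ _ (H (\bigcup_i [set t | G i (t, f t)]))); first exact: le_hmeasure.
apply: (le_trans (hmeasure_sigma_subadditive _ _ _)).
by rewrite eseries0// => i _ _; exact: G0.
Qed.

Lemma Gamma_null_sub (G G' : set (V * Y)) : G `<=` G' ->
  Gamma_null alpha G' -> Gamma_null alpha G.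
Proof.
move=> GG' G'0 f fL; apply/eqP; rewrite eq_le hmeasure_ge0 andbT.
by rewrite -(G'0 f fL); apply: le_hmeasure => t; exact: GG'.
Qed.

Lemma elipschitz_norm (f : V -> Y) : elipschitz f ->
  exists L : R, forall s t, (`|f s - f t| <= L * `|s - t|)%R.
Proof.
move=> [L fL]; exists (`|L| * Ck)%R => s t.
apply: (le_trans (edistv_ge _ _)); apply: (le_trans (fL s t)).
apply: (@le_trans _ _ (`|L| * edistv s t)%R).
  by rewrite ler_wpM2r ?ler_norm// sqrtr_ge0.
by rewrite -mulrA ler_wpM2l//; exact: edistv_le.
Qed.

Lemma ball_compact (m : nat) (x : 'rV[R]_m) (r : R) :
  compact [set y : 'rV[R]_m | (`|x - y| <= r)%R].
Proof.
apply: bounded_closed_compact.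
  exists (`|x| + r)%R; split; first exact: num_real.
  move=> M xrM y /= xy; rewrite (le_trans _ (ltW xrM))//.
  have -> : y = (x - (x - y))%R by rewrite opprB addrC subrK.
  by rewrite (le_trans (ler_normB _ _))// lerD2l.
exact: closed_dist_le.
Qed.

(** [B] is cut into countably many pieces lying in compact boxes, where the localized measure is
    finite and satisfies the lower bound. Both kinds of null sets are stable under countable
    unions. *)
Lemma regular_decomposition (B : set (V * Y)) (q gam : R) : (0 < q)%R -> (0 < gam)%R ->
  borel B -> base_proj B `<=` T -> (forall t, ball_null q (xsection B t)) ->
  exists G, [/\ borel G, G `<=` B, Gamma_null alpha G &
    ball_null (alpha + q + gam) (B `\` G)].
Proof.
move=> q0 gam0 bB BT Bnull.
have [tt [Ttt Tcov]] := separable_cover rho_gt0 T_neq0.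
have rho01 : (0 < rho <= 1)%R.
  by rewrite rho_gt0 (le_trans _ rho_le)// ler_peMl ?ler1n// ltW.
pose Bp i j := B `&` (ball (tt i) rho `*` ball (0%R : Y) j.+1%:R).
have Bcov : B `<=` \bigcup_i \bigcup_j Bp i j.
  move=> [t y] Bty; have [i _ ti] : (\bigcup_i ball (tt i) rho) t.
    by apply: Tcov; apply: BT; exists (t, y).
  exists i => //; exists (`|Num.ceil `|y|%R|)%N => //; split=> //; split=> //=.
  rewrite -ball_normE /= sub0r normrN -natr1 natr_absz ger0_norm ?ceil_ge0//.
    by rewrite (le_lt_trans (ceil_ge _))// ltrDl.
  by rewrite (lt_le_trans (ltrN10 _)).
have piece i j : exists G, [/\ borel G, G `<=` Bp i j, Gamma_null alpha G &
    ball_null (alpha + q + gam) (Bp i j `\` G)].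
  pose K0 : set (V * Y) := [set t | (`|tt i - t| <= rho)%R] `*`
    [set y : Y | (`|0%R - y| <= j.+1%:R)%R].
  have bBp : borel (Bp i j).
    apply: borelI => //; apply: borel_open.
    by apply: open_prod; exact: ball_open.
  have BK : Bp i j `<=` K0.
    by move=> z [_ []]; rewrite -!ball_normE /= => ? ?; split; exact: ltW.
  have cK : compact K0 by apply: compact_setX; exact: ball_compact.
  have BT0 z : Bp i j z -> (T `&` ball (tt i) rho) z.1.
    by move=> [Bz [tz _]]; split=> //; apply: BT; exists z.
  have Bpnull t : ball_null q (xsection (Bp i j) t).
    by apply: ball_null_sub (Bnull t) => y; rewrite /xsection /= !inE => -[].
  have [G [bG GB Gnull Bnull']] := lipschitz_null_decomposition (@dyadic_net R n)
    (@local_open (tt i)) (local_fin (Ttt i)) alpha_gt0 q0 gam0 c_gt0 rho01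
    (@local_lower (tt i)) bBp BK cK BT0 Bpnull.
  exists G; split=> // f /elipschitz_norm[L fL].
  rewrite (@local_sub (tt i)); first exact: Gnull fL.
  by move=> t /GB/BT0.
have /choice[G GP] i : exists G : nat -> set (V * Y), forall j,
    [/\ borel (G j), G j `<=` Bp i j, Gamma_null alpha (G j) &
    ball_null (alpha + q + gam) (Bp i j `\` G j)].
  by have /choice[G GP] := piece i; exists G.
exists (\bigcup_i \bigcup_j G i j); split.
- by apply: borel_bigcup => i; apply: borel_bigcup => j; have [] := GP i j.
- by move=> z [i _ [j _ Gz]]; have [_ /(_ _ Gz)[]] := GP i j.
- apply: Gamma_null_bigcup => i; apply: Gamma_null_bigcup => j.
  by have [] := GP i j.
apply: (@ball_null_sub _ _ _ _ (\bigcup_i \bigcup_j (Bp i j `\` G i j))).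
  move=> z [/Bcov[i _ [j _ Bz]] nG]; exists i => //; exists j => //; split=> // Gz.
  by apply: nG; exists i => //; exists j.
by apply: ball_null_bigcup => i; apply: ball_null_bigcup => j; have [] := GP i j.
Qed.

(** * Optimal removal and the dimension formula *)

Local Notation dp := (@edistp R k n).

Let Cp_gt0 : (0 < k%:R + 1 + (n%:R + 1) :> R)%R.
Proof. by rewrite addr_gt0. Qed.

Lemma hdim_base_le (A : set (V * Y)) : base_proj A `<=` T ->
  hdim (@edistv R k) (base_proj A) <= alpha%:E.
Proof.
move=> AT; apply: hdim_le_approx; first exact: ltW.
move=> s als; apply/eqP; rewrite eq_le hmeasure_ge0 andbT.
by rewrite -(regular_hmeasure_null als); exact: le_hmeasure.
Qed.

Lemma hdim_base_ge (A : set (V * Y)) : H (base_proj A) != 0 ->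
  alpha%:E <= hdim (@edistv R k) (base_proj A).
Proof.
move=> A0; rewrite leNgt; apply/negP => lt; move/eqP: A0; apply.
exact: (hdim_lt_null (@edistv_ge R k) (@edistv_le R k) Ck_gt0 lt).
Qed.

(** For [s] above the dimension of [A] and [q > s - alpha], the set [A] is null at exponent
    [alpha + q], so almost all sections have dimension at most [q]. The non-null base gives
    [alpha <= s], which handles the lower bound 0 in the definition of the supremum. *)
Lemma sup_dim_section_le_hdim (A : set (V * Y)) : base_proj A `<=` T ->
  H (base_proj A) != 0 -> alpha%:E + sup_dim_section alpha A <= hdim dp A.
Proof.
move=> AT A0; have := hdim_ge0 dp A.
case E : (hdim dp A) => [h| |] // h0; last by rewrite leey.
apply/lee_addgt0Pr => e e0; rewrite -EFinD; set s := (h + e)%R.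
have s0 : (0 < s)%R by rewrite ltr_wpDl// -lee_fin.
have As : ball_null s A.
  apply: (hmeasure_ball_null (@edistp_ge R k n) s0).
  apply: (hdim_lt_null (@edistp_ge R k n) (@edistp_le R k n) Cp_gt0).
  by rewrite E lte_fin ltrDl.
have als : (alpha <= s)%R.
  rewrite leNgt; apply/negP => sal; move/eqP: A0; apply.
  exact: (regular_base_null AT (ball_null_exp s0 (ltW sal) As)).
suff : sup_dim_section alpha A <= (s - alpha)%:E.
  by move=> /(leeD2l alpha%:E)/le_trans; apply; rewrite -EFinD subrKC.
rewrite /sup_dim_section ge_max lee_fin subr_ge0 als /=.
apply: ge_ereal_sup => _ [q [q0 Hq] <-]; rewrite lee_fin leNgt; apply/negP => sq.
have {}q0 : (0 < q)%R by rewrite (le_lt_trans _ sq)// subr_ge0.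
have Aq : ball_null (alpha + q) A.
  by apply: ball_null_exp s0 _ As; rewrite -lerBlDl ltW.
move: Hq; rewrite ltNge => /negP; apply.
rewrite -(regular_sections_null AT q0 Aq); apply: le_hmeasure => t /= qt Atq.
move: qt; rewrite ltNge => /negP; apply; apply: hdim_le; first exact: ltW.
exact: (ball_null_hmeasure (@edistv_ge R n) (@edistv_le R n) Cn_gt0 q0 Atq).
Qed.

Let admissible (B G : set (V * Y)) := [/\ borel G, G `<=` B & Gamma_null alpha G].

Let admissible_bigcup B (G : nat -> set (V * Y)) : (forall i, admissible B (G i)) ->
  admissible B (\bigcup_i G i).
Proof.
move=> BG; split.
- by apply: borel_bigcup => i; have [] := BG i.
- by move=> z [i _]; have [_ + _] := BG i; exact.
- by apply: Gamma_null_bigcup => i; have [] := BG i.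
Qed.

Let admissibleU B (G G' : set (V * Y)) : admissible B G -> admissible B G' ->
  admissible B (G `|` G').
Proof.
move=> BG BG'; have -> : G `|` G' = \bigcup_i (if i is 0%N then G else G').
  apply/seteqP; split=> [z [Gz|Gz]|z [[|i] _ Gz]]; [by exists 0%N|by exists 1%N|..].
    by left.
  by right.
by apply: admissible_bigcup => -[].
Qed.

(** The union of a minimizing sequence of admissible sets attains the infimum. If the infimum is
    infinite, the empty set will do. *)
Lemma minimal_remainder (B : set (V * Y)) : exists2 G, admissible B G &
  forall G', admissible B G' -> hdim dp (B `\` G) <= hdim dp (B `\` G').
Proof.
pose S := [set hdim dp (B `\` G) | G in admissible B].
have S0 : admissible B set0.
  split=> // [|f _]; first by apply: borel_open; exact: open0.
  by rewrite (_ : [set t | _] = set0) ?hmeasure0.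
have inf_ge0 : 0 <= ereal_inf S.
  by apply: le_ereal_inf_tmp => _ [G _ <-]; exact: hdim_ge0.
case E : (ereal_inf S) => [b| |].
- have /choice[G GP] i : exists G, admissible B G /\
      hdim dp (B `\` G) <= (b + i.+1%:R^-1)%:E.
    have i0 : (0 < i.+1%:R^-1 :> R)%R by rewrite invr_gt0.
    have [|_ [G BG <-] lt] := @lb_ereal_inf_adherent _ S _ i0; first by rewrite E.
    by exists G; split=> //; rewrite EFinD -E ltW.
  exists (\bigcup_i G i); first by apply: admissible_bigcup => i; have [] := GP i.
  move=> G' BG'; apply: (@le_trans _ _ b%:E); last first.
    by rewrite -E; apply: ereal_inf_lbound; exists G'.
  apply/lee_addgt0Pr => e e0; have [m _ hm] := near_infty_natSinv_lt (PosNum e0).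
  apply: (@le_trans _ _ (hdim dp (B `\` G m))).
    by apply: le_hdim => z [Bz nG]; split=> // Gz; apply: nG; exists m.
  by apply: (le_trans (GP m).2); rewrite -EFinD lee_fin lerD2l ltW// hm/=.
- exists set0 => // G' BG'; apply: (@le_trans _ _ +oo); first exact: leey.
  by rewrite -E; apply: ereal_inf_lbound; exists G'.
- by rewrite E in inf_ge0.
Qed.

(** Removing also the exceptional sections, and then the set supplied by [regular_decomposition], is
    still admissible; by minimality the dimension of the original remainder obeys the same bound. *)
Lemma minimal_remainder_hdim (B : set (V * Y)) : borel B -> base_proj B `<=` T ->
  exists2 G, admissible B G &
    hdim dp (B `\` G) <= alpha%:E + sup_dim_section alpha (B `\` G).
Proof.
move=> bB BT; have [G0 adG0 G0min] := minimal_remainder B; exists G0 => //.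
set B' := B `\` G0.
have : 0 <= sup_dim_section alpha B' by rewrite /sup_dim_section le_max lexx.
case E : (sup_dim_section alpha B') => [b| |] // b0; last by rewrite addey// leey.
rewrite lee_fin in b0; apply/lee_addgt0Pr => e e0; rewrite -!EFinD.
(* Three losses: the strict excess over the essential supremum, the passage from dimension to
   nullity of the sections, and the exponent [gam]. *)
pose eta := (e / 3)%R; have eta0 : (0 < eta)%R by rewrite divr_gt0.
have q0 : (0 < b + eta + eta)%R by rewrite addr_gt0// ltr_wpDl.
have bB' : borel B' by apply: borelD => //; have [] := adG0.
have B'T : base_proj B' `<=` T by move=> t [z [Bz _] <-]; apply: BT; exists z.
have [N' [bN' NN' N'0]] : exists N', [/\ borel N',
    [set t | (b + eta)%:E < hdim (@edistv R n) (xsection B' t)] `<=` N' & H N' = 0].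
  apply: null_borel_hull; apply/eqP; rewrite eq_le hmeasure_ge0 andbT leNgt.
  apply/negP => Hq; suff : (b + eta)%:E <= b%:E by rewrite lee_fin gerDl leNgt eta0.
  rewrite -E /sup_dim_section le_max; apply/orP; right.
  apply: ereal_sup_ubound; exists (b + eta)%R => //; split=> //.
  by rewrite addr_ge0// ltW.
(* It lies over a null set, hence is null on every graph; it is Borel because [N'] is. *)
pose G1 := B' `&` fst @^-1` N'.
have adG1 : admissible B G1.
  split.
  - by apply: borelI => //; apply: borel_preimage bN' => x; exact: cvg_fst.
  - by move=> z [[]].
  - move=> f _; apply/eqP; rewrite eq_le hmeasure_ge0 andbT -N'0.
    by apply: le_hmeasure => t [].
pose B'' := B' `\` G1.
have bB'' : borel B'' by apply: borelD => //; have [] := adG1.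
have B''T : base_proj B'' `<=` T by move=> t [z [Bz _] <-]; apply: B'T; exists z.
have B''null t : ball_null (b + eta + eta) (xsection B'' t).
  have [N't|nN't] := pselect (N' t).
    rewrite (_ : xsection _ _ = set0); first exact: ball_gauge0.
    apply/seteqP; split=> // y; rewrite /xsection /= inE => -[B'z nG1].
    by apply: nG1; split.
  apply: (@ball_null_sub _ _ _ _ (xsection B' t)).
    by move=> y; rewrite /xsection /= !inE => -[].
  apply: (hmeasure_ball_null (@edistv_ge R n) q0).
  apply: (hdim_lt_null (@edistv_ge R n) (@edistv_le R n) Cn_gt0).
  apply: (@le_lt_trans _ _ (b + eta)%:E); last by rewrite lte_fin ltrDl.
  by rewrite leNgt; apply/negP => h; apply: nN't; exact: NN'.
have [G2 [bG2 G2B G2null B''G2]] := regular_decomposition q0 eta0 bB'' B''T B''null.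
have adG2 : admissible B G2 by split=> // z /G2B[[]].
apply: (le_trans (G0min _ (admissibleU (admissibleU adG0 adG1) adG2))).
have s0 : (0 < alpha + (b + eta + eta) + eta)%R by rewrite addr_gt0// addr_gt0.
apply: (@le_trans _ _ (alpha + (b + eta + eta) + eta)%:E).
  apply: hdim_le; first exact: ltW.
  apply: (ball_null_hmeasure (@edistp_ge R k n) (@edistp_le R k n) Cp_gt0 s0).
  apply: ball_null_sub B''G2 => z [Bz nG]; split.
    split; first by split=> // G0z; apply: nG; left; left.
    by move=> G1z; apply: nG; left; right.
  by move=> G2z; apply: nG; right.
by rewrite lee_fin /eta; lra.
Qed.

Theorem fubini_remainder (B : set (V * Y)) : borel B -> base_proj B `<=` T ->
  ~ Gamma_null alpha B -> exists G, [/\ borel G, G `<=` B, Gamma_null alpha G,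
    fubini_property (B `\` G) &
    hdim (@edistv R k) (base_proj (B `\` G)) = alpha%:E /\
    hdim dp (B `\` G) = alpha%:E + ess_sup_dim alpha (B `\` G)].
Proof.
move=> bB BT nB; have [G adG Gle] := minimal_remainder_hdim bB BT.
have [bG GB G0] := adG; exists G.
have B'T : base_proj (B `\` G) `<=` T by move=> t [z [Bz _] <-]; apply: BT; exists z.
(* A graph point of [B] lies either in [G] or over the base of the remainder; were this base null,
   [B] itself would be [Gamma_null]. *)
have B'0 : H (base_proj (B `\` G)) != 0.
  apply/eqP => h; apply: nB => f fL; apply/eqP; rewrite eq_le hmeasure_ge0 andbT.
  apply: (@le_trans _ _ (H ([set t | G (t, f t)] `|` base_proj (B `\` G)))).
    apply: le_hmeasure => t Bt; have [Gt|nGt] := pselect (G (t, f t)); first by left.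
    by right; exists (t, f t).
  by apply: (le_trans (outer_measureU2 _ _ _)); rewrite /= G0// h adde0.
have base_dim : hdim (@edistv R k) (base_proj (B `\` G)) = alpha%:E.
  by apply/eqP; rewrite eq_le hdim_base_le//= hdim_base_ge.
have essE : ess_sup_dim alpha (B `\` G) = sup_dim_section alpha (B `\` G).
  by rewrite /ess_sup_dim lt_def B'0 hmeasure_ge0.
have dimE : hdim dp (B `\` G) = alpha%:E + ess_sup_dim alpha (B `\` G).
  by rewrite essE; apply/eqP; rewrite eq_le Gle sup_dim_section_le_hdim.
split; [exact: bG|exact: GB|exact: G0| |by split].
split; last by rewrite base_dim /=; exact: dimE.
apply: contrapT => B'e; move/eqP: B'0; apply; rewrite -[RHS](hmeasure0 (@edistv R k) alpha).
by congr (H _); apply/seteqP; split=> // t [z B'z _]; apply: B'e; exists z.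
Qed.

End ADRegular.

(** * One-point remainders and the conclusion *)

Section Singleton.
Context {R : realType} (k n : nat).
Local Open Scope ereal_scope.

(** The base has dimension 0 and positive counting measure, so the first branch of [ess_sup_dim]
    applies; no section has positive dimension. *)
Lemma fubini_property_set1 (p : 'rV[R]_k * 'rV[R]_n) : fubini_property [set p].
Proof.
split; first by exists p.
have Ck0 : (0 < k%:R + 1 :> R)%R by rewrite ltr_wpDl.
have Cn0 : (0 < n%:R + 1 :> R)%R by rewrite ltr_wpDl.
have -> : base_proj [set p] = [set p.1] by rewrite /base_proj image_set1.
rewrite (hdim_set1 (@edistv_ge R k) (@edistv_le R k) Ck0) /=.
rewrite (hdim_set1 (@edistp_ge R k n) (@edistp_le R k n) (addr_gt0 Ck0 Cn0)).
rewrite add0e /ess_sup_dim.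
have -> : base_proj [set p] = [set p.1] by rewrite /base_proj image_set1.
have H0 : 0 < hmeasure (@edistv R k) 0 [set p.1].
  rewrite lt_def hmeasure_ge0 andbT; apply/eqP => /hmeasure0_eq0.
  by move=> /seteqP[/(_ p.1 erefl)].
rewrite H0 /sup_dim_section (_ : [set q%:E | q in _] = set0).
  by rewrite ereal_sup0; apply/esym/max_idPl; rewrite leNye.
apply/seteqP; split=> // x [q [q0 Hq] _]; move: Hq.
rewrite (_ : [set t | _] = set0) ?hmeasure0 ?ltxx//.
apply/seteqP; split=> // t /=; apply/negP; rewrite -leNgt.
apply: (@le_trans _ _ 0); last by rewrite lee_fin.
rewrite -(hdim_set1 (@edistv_ge R n) (@edistv_le R n) Cn0 p.2).
by apply: le_hdim => y; rewrite /xsection /= inE => <-.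
Qed.

End Singleton.

Theorem corollary4p1 (R : realType) (n k : nat) (alpha : R)
    (T : set 'rV[R]_k) (B : set ('rV[R]_k * 'rV[R]_n)) :
  (1 <= n)%N -> (1 <= k)%N ->
  0 < alpha <= k%:R ->
  B !=set0 -> borel B ->
  ad_regular alpha T ->
  base_proj B `<=` T ->
  exists G : set ('rV[R]_k * 'rV[R]_n),
    [/\ borel G, G `<=` B, Gamma_null alpha G,
        fubini_property (B `\` G) &
        ~ Gamma_null alpha B ->
          hdim (@edistv R k) (base_proj (B `\` G)) = alpha%:E /\
          hdim (@edistp R k n) (B `\` G) =
            (alpha%:E + ess_sup_dim alpha (B `\` G))%E].
Proof.
move=> _ _ /andP[alpha0 _] [p Bp] bB [_ [c [c' [c0 c'0 Treg]]]] BT.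
have T0 : T !=set0 by exists p.1; apply: BT; exists p.
have [nB|nB] := pselect (Gamma_null alpha B); last first.
  have [G [? ? ? ? ?]] := fubini_remainder alpha0 c0 c'0 Treg T0 bB BT nB.
  by exists G.
(* One point is kept because the Fubini property requires a nonempty set. *)
exists (B `\ p); split=> //.
- apply: borelD => //; apply: borel_closed.
  by apply: accessible_closed_set1; apply: hausdorff_accessible; exact: norm_hausdorff.
- by apply: Gamma_null_sub nB => z [].
rewrite (_ : B `\` _ = [set p]); first exact: fubini_property_set1.
apply/seteqP; split=> [z [Bz nz]|_ ->]; first by apply: contrapT => zp; apply: nz.
by split=> // -[_]; exact.
Qed.
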